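(* There exists an algorithm that, given copies of an unknown $n$-qubit state $\rho$, answers $M$ adaptively chosen rank-one projectors $|\psi^1\rangle\langle\psi^1|,\dots,|\psi^M\rangle\langle\psi^M|$, outputting estimates of $\langle\psi^i|\rho|\psi^i\rangle$ within error $\epsilon$ for all $i$, with probability at least $1-\delta$, using $$N=\mathcal{O}\left(\frac{\log(M)\log(1/\epsilon\delta)^{3/2}\log(1/\epsilon)}{\epsilon^3}\right)$$ copies of $\rho$.
   Context: Adaptive model: in round $i$ a classical analyst chooses the unit vector $|\psi^i\rangle$ possibly depending on all previous queries and answers; the algorithm (which may be computationally inefficient) returns an estimate $\hat o_i$. *)

(* Defs.v *)
From HB Require Import structures.
From mathcomp Require Import all_boot all_order all_algebra.
From mathcomp Require Import all_classical all_reals exp.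
From mathcomp Require Export complex.

Set Implicit Arguments.
Unset Strict Implicit.
Unset Printing Implicit Defensive.

Import Order.TTheory GRing.Theory Num.Theory.
Local Open Scope ring_scope.

Section Quantum.
Variable R : realType.
Local Notation C := R[i].

Definition mxadj m n (A : 'M[C]_(m, n)) : 'M[C]_(n, m) := (map_mx conjc A)^T.

Definition density_matrix d (rho : 'M[C]_d) : Prop :=
  [/\ mxadj rho = rho,
      (forall v : 'cV[C]_d, 0 <= (mxadj v *m rho *m v) 0 0)
    & \tr rho = 1].

Definition unit_vector d (psi : 'cV[C]_d) : Prop := (mxadj psi *m psi) 0 0 = 1.

(* <psi| rho |psi>  (real for Hermitian rho) *)
Definition expval d (rho : 'M[C]_d) (psi : 'cV[C]_d) : R :=
  @complex.Re R ((mxadj psi *m rho *m psi) 0 0).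

(* N-fold tensor power rho^{(x)N}, the basis of (C^d)^{(x)N} being indexed
   by functions 'I_N -> 'I_d (enumerated via enum_val). *)
Definition copies_dim d N : nat := #|{ffun 'I_N -> 'I_d}|.

Definition tens_pow d N (rho : 'M[C]_d) : 'M[C]_(copies_dim d N) :=
  \matrix_(i, j) \prod_(k < N)
      rho ((enum_val i : {ffun 'I_N -> 'I_d}) k) ((enum_val j : {ffun 'I_N -> 'I_d}) k).

Definition history d := seq ('cV[C]_d * R).

(* A (possibly inefficient) quantum algorithm holding N copies of the
   d-dimensional state, with a K-dimensional quantum memory:
   - alg_init : Kraus operators of an arbitrary channel loading
                rho^{(x)N} into the memory (allows ancillas / processing);
   - in each round, given the transcript and the query psi, it applies a
     quantum instrument with outcomes o : 'I_L (Kraus operators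
     alg_kraus h psi o l, l : 'I_J) and outputs alg_est h psi o. *)
Record algorithm d N K L J := Algorithm {
  alg_init : 'I_J -> 'M[C]_(K, copies_dim d N);
  alg_kraus : history d -> 'cV[C]_d -> 'I_L -> 'I_J -> 'M[C]_K;
  alg_est : history d -> 'cV[C]_d -> 'I_L -> R }.

Definition valid_algorithm d N K L J (alg : algorithm d N K L J) : Prop :=
  (\sum_(l < J) mxadj (alg_init alg l) *m alg_init alg l = 1%:M) /\
  (forall h psi,
     \sum_(o < L) \sum_(l < J)
        mxadj (alg_kraus alg h psi o l) *m alg_kraus alg h psi o l = 1%:M).

(* Unnormalised probability that the remaining m rounds all succeed, from
   transcript h and (unnormalised) memory state sigma, against the adaptive
   analyst A (a function of the transcript). *)
Fixpoint success_weight d N K L J (rho : 'M[C]_d) (alg : algorithm d N K L J)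
    (A : history d -> 'cV[C]_d) (eps : R) (m : nat) (h : history d)
    (sigma : 'M[C]_K) : C :=
  match m with
  | 0 => \tr sigma
  | m'.+1 =>
      let psi := A h in
      \sum_(o < L)
        (if `|alg_est alg h psi o - expval rho psi| <= eps then
           success_weight rho alg A eps m' (rcons h (psi, alg_est alg h psi o))
             (\sum_(l < J) alg_kraus alg h psi o l *m sigma
                              *m mxadj (alg_kraus alg h psi o l))
         else 0)
  end.

Definition success_prob d N K L J (rho : 'M[C]_d) (alg : algorithm d N K L J)
    (A : history d -> 'cV[C]_d) (eps : R) (M : nat) : C :=
  success_weight rho alg A eps M [::]
    (\sum_(l < J) alg_init alg l *m tens_pow N rho *m mxadj (alg_init alg l)).

End Quantum.

(* Main.v *)
Require Import Defs.
From HB Require Import structures.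
From mathcomp Require Import all_boot all_order all_algebra.
From mathcomp Require Import all_classical all_reals sequences exp.
From mathcomp Require Import complex.
From mathcomp Require Import ring lra zify.
Import Order.TTheory GRing.Theory Num.Theory.
Local Open Scope ring_scope.
Set Implicit Arguments.
Unset Strict Implicit.
Unset Printing Implicit Defensive.

(** Each copy is measured separately with a rank-one POVM whose random vectors match
    a complex Gaussian up to fourth moments.  For a unit vector psi the statistic
    |<psi|g>|^2 - 1 is then an unbiased estimator of <psi|rho|psi> with variance
    bounded independently of the dimension, so by Chebyshev the mean over a group
    of O(1/eps^2) copies is accurate with probability at least 99/100.

    A hypothesis matrix W is maintained by perceptron updates along the queried
    projectors.  Each justified update lowers the squared Frobenius distance to rho,
    at most 1 initially, by eps^2/16, so there are T = O(1/eps^2) of them.  Whether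
    an update is needed is decided by a vote of G groups, randomised through the
    logistic function at temperature sigma.

    The answers reveal little about any single group: likelihood ratios for
    neighbouring data form a supermartingale charged only to the T updates, which
    gives approximate differential privacy for sigma of order sqrt(T log(1/delta)).
    A decision contradicting the truth needs a quarter of the groups to be wrong,
    whereas by privacy each group is wrong about the test in question with
    probability at most about e/100.  The required G is of order
    sigma log(M/(eps delta)).  When log(1/(eps delta)) exceeds 1/eps^2 a union bound
    over all sequences of answers is cheaper. *)

(** * Finite product distributions: moments, resampling and regrouping *)

Section ProductDistributions.
Variable R : realFieldType.

Definition prodw (X I : finType) (P : X -> R) (s : {ffun I -> X}) : R :=
  \prod_i P (s i).

Definition upd (X I : finType) (s : {ffun I -> X}) (j : I) (y : X) : {ffun I -> X} :=
  [ffun i => if i == j then y else s i].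

Lemma prodw_ge0 (X I : finType) (P : X -> R) (s : {ffun I -> X}) :
  (forall x, 0 <= P x) -> 0 <= prodw P s.
Proof. by move=> P0; apply: prodr_ge0. Qed.

Lemma prodw_sum1 (X I : finType) (P : X -> R) :
  \sum_x P x = 1 -> \sum_(s : {ffun I -> X}) prodw P s = 1.
Proof.
move=> P1; rewrite /prodw -(bigA_distr_bigA (fun (_ : I) x => P x)).
by rewrite big1.
Qed.

Lemma prodw_prod (X I : finType) (P : X -> R) (f : I -> X -> R) :
  \sum_(s : {ffun I -> X}) prodw P s * \prod_i f i (s i) =
  \prod_i \sum_x P x * f i x.
Proof.
rewrite (bigA_distr_bigA (fun (i : I) x => P x * f i x)).
by apply: eq_bigr => s _; rewrite big_split.
Qed.

Lemma upd_updK (X I : finType) (s : {ffun I -> X}) j y : upd (upd s j y) j (s j) = s.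
Proof. by apply/ffunP => i; rewrite !ffunE; case: eqP => // ->. Qed.

Lemma upd_same (X I : finType) (s : {ffun I -> X}) j y : upd s j y j = y.
Proof. by rewrite ffunE eqxx. Qed.

Lemma prodw_upd (X I : finType) (P : X -> R) (s : {ffun I -> X}) j y :
  prodw P s * P y = prodw P (upd s j y) * P (s j).
Proof.
rewrite /prodw (bigD1 j) //= [in RHS](bigD1 j) //= upd_same.
rewrite [X in _ = _ * X * _](eq_bigr (fun i => P (s i))); first by ring.
by move=> i /negPf ij; rewrite ffunE ij.
Qed.

(** Exchanging entry [j] with a fresh draw is an involution that preserves the joint weight. This
    lets [hit_le] treat the tested entry as independent of the data. *)
Lemma prodw_resample (X I : finType) (P : X -> R) (j : I)
    (F : {ffun I -> X} -> X -> R) :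
  \sum_s \sum_y prodw P s * P y * F s y =
  \sum_s \sum_y prodw P s * P y * F (upd s j y) (s j).
Proof.
rewrite !pair_big /=.
pose g (p : {ffun I -> X} * X) := (upd p.1 j p.2, p.1 j).
have gK : involutive g by case=> s y; rewrite /g /= upd_updK upd_same.
rewrite [LHS](reindex_inj (inv_inj gK)) /=.
by apply: eq_bigr => -[s y] _ /=; rewrite -prodw_upd.
Qed.

Lemma prodw_marginal (X I : finType) (P : X -> R) (j : I) (f : X -> R) :
  \sum_x P x = 1 ->
  \sum_(s : {ffun I -> X}) prodw P s * f (s j) = \sum_x P x * f x.
Proof.
move=> P1.
transitivity (\sum_(s : {ffun I -> X}) prodw P s * \prod_i (if i == j then f (s i) else 1)).
  by apply: eq_bigr => s _; rewrite -big_mkcond big_pred1_eq.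
rewrite (prodw_prod P (fun i x => if i == j then f x else 1)).
rewrite (bigD1 j) //= eqxx [X in _ * X]big1 ?mulr1 // => i /negPf ->.
by under eq_bigr do rewrite mulr1.
Qed.

Lemma prodw_marginal2 (X I : finType) (P : X -> R) (i j : I) (f g : X -> R) :
  \sum_x P x = 1 -> i != j ->
  \sum_(s : {ffun I -> X}) prodw P s * (f (s i) * g (s j)) =
  (\sum_x P x * f x) * (\sum_x P x * g x).
Proof.
move=> P1 ij.
pose F k x := (if k == i then f x else 1) * (if k == j then g x else 1).
transitivity (\sum_(s : {ffun I -> X}) prodw P s * \prod_k F k (s k)).
  by apply: eq_bigr => s _; rewrite big_split /= -!big_mkcond !big_pred1_eq.
rewrite prodw_prod (bigD1 i) //= (bigD1 j) 1?eq_sym //= /F eqxx.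
rewrite [j == i]eq_sym (negPf ij) eqxx [X in _ * (_ * X)]big1.
  rewrite mulr1; congr (_ * _); apply: eq_bigr => x _; first by rewrite mulr1.
  by rewrite mul1r.
by move=> k /andP[/negPf -> /negPf ->]; under eq_bigr do rewrite mul1r mulr1.
Qed.

(** Only the diagonal of the expanded square survives: the cross terms factor into products of zero
    means. *)
Lemma prodw_sum_sqr (X I : finType) (P : X -> R) (f : X -> R) :
  \sum_x P x = 1 -> \sum_x P x * f x = 0 ->
  \sum_(s : {ffun I -> X}) prodw P s * (\sum_i f (s i)) ^+ 2 =
  #|I|%:R * \sum_x P x * f x ^+ 2.
Proof.
move=> P1 f0.
transitivity (\sum_(i : I) \sum_(j : I) \sum_(s : {ffun I -> X}) prodw P s * (f (s i) * f (s j))).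
  under [RHS]eq_bigr do rewrite exchange_big /=.
  rewrite exchange_big /=; apply: eq_bigr => s _.
  rewrite expr2 big_distrlr big_distrr /=; apply: eq_bigr => i _.
  by rewrite big_distrr.
rewrite -sum1_card natr_sum mulr_suml; apply: eq_bigr => i _.
rewrite mul1r (bigD1 i) //= [X in _ + X]big1 => [|j ji].
  by rewrite addr0 -(prodw_marginal i (fun x => f x ^+ 2)).
by rewrite prodw_marginal2 // 1?eq_sym // f0 mul0r.
Qed.

Lemma chebyshev (X : finType) (P : X -> R) (f : X -> R) (a v : R) :
  (forall x, 0 <= P x) -> 0 < a -> \sum_x P x * f x ^+ 2 <= v ->
  \sum_(x | a <= `|f x|) P x <= v / a ^+ 2.
Proof.
move=> P0 a0 hv; rewrite ler_pdivlMr ?exprn_gt0 //; apply: le_trans hv.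
rewrite mulr_suml big_mkcond /=; apply: ler_sum => x _.
case: ifP => hx; last by rewrite mulr_ge0 // sqr_ge0.
by rewrite ler_wpM2l // -(real_normK (num_real (f x))) lerXn2r ?nnegrE // ltW.
Qed.

Definition blocks (X : finType) (G m : nat) (s : {ffun 'I_(G * m) -> X}) :
    {ffun 'I_G -> {ffun 'I_m -> X}} :=
  [ffun j => [ffun k => s (mxvec_index j k)]].

(** The algorithm measures [G * m] copies in one flat register, while the analysis needs [G]
    independent groups; [mxvec_index] is the bijection between the two index sets. *)
Lemma prodw_blocks (X : finType) (G m : nat) (P : X -> R)
    (F : {ffun 'I_G -> {ffun 'I_m -> X}} -> R) :
  \sum_(s : {ffun 'I_(G * m) -> X}) prodw P s * F (blocks s) =
  \sum_(S : {ffun 'I_G -> {ffun 'I_m -> X}}) prodw (prodw P) S * F S.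
Proof.
pose ub (S : {ffun 'I_G -> {ffun 'I_m -> X}}) : {ffun 'I_(G * m) -> X} :=
  [ffun k => let: (i, j) := pair_of_mxvec_index (mxvec_indexP k) in S i j].
have blK : cancel ub (@blocks X G m).
  move=> S; apply/ffunP => i; apply/ffunP => j; rewrite !ffunE.
  have inj := bij_inj (onT_bij (curry_mxvec_bij G m)).
  move: (mxvec_indexP (mxvec_index i j)); move eq_k: (mxvec_index i j) => k ik.
  case: ik eq_k => i' j' /= eq_k.
  by move: (inj (i, j) (i', j') eq_k) => -[-> ->].
have ubK : cancel (@blocks X G m) ub.
  move=> s; apply/ffunP => k; rewrite !ffunE.
  by case: (mxvec_indexP k) => i j /=; rewrite !ffunE.
rewrite [RHS](reindex (@blocks X G m)) /=; last first.
  by apply: onW_bij; exists ub.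
apply: eq_bigr => s _; congr (_ * _); rewrite /prodw.
under [in RHS]eq_bigr do under eq_bigr do rewrite !ffunE.
rewrite (reindex _ (curry_mxvec_bij G m)) pair_big /=.
by apply: eq_bigr => -[i j] _.
Qed.
End ProductDistributions.

(** * The logistic function and its one-step Renyi bound *)

Section Logistic.
Variable R : realType.
Implicit Types x d k : R.

Lemma expR_half_le2 : expR 2^-1 <= 2 :> R.
Proof.
have e0 := expR_gt0 (2^-1 : R).
have := expR_ge1Dx (- (2^-1 : R)); rewrite expRN => /(ler_wpM2r (ltW e0)).
by rewrite mulVf ?gt_eqF //; lra.
Qed.

Lemma expR1_le4 : expR 1 <= 4 :> R.
Proof.
have h := expR_half_le2.
have -> : expR 1 = expR 2^-1 ^+ 2 :> R by rewrite -expRM_natl mulfV ?pnatr_eq0.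
have := expR_ge0 (2^-1 : R); nra.
Qed.

Definition logistic x : R := (1 + expR (- x))^-1.

Lemma logistic_gt0 x : 0 < logistic x.
Proof. by rewrite invr_gt0 addr_gt0 ?ltr01 ?expR_gt0. Qed.

Lemma logisticN x : logistic (- x) = 1 - logistic x.
Proof.
have e0 := expR_gt0 x.
rewrite /logistic opprK expRN; field.
by rewrite !gt_eqF // addr_gt0.
Qed.

Lemma logistic_lt1 x : logistic x < 1.
Proof. by rewrite -subr_gt0 -logisticN logistic_gt0. Qed.

Lemma logistic_le_expR x : logistic x <= expR x.
Proof.
by rewrite /logistic -[leRHS]invrK -expRN lef_pV2 ?posrE ?addr_gt0 ?expR_gt0 // lerDr.
Qed.

Lemma logistic_shift_le x d : logistic (x + d) <= expR `|d| * logistic x.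
Proof.
rewrite /logistic; have e1 := expR_gt0 (- x); have e2 := expR_gt0 (- (x + d)).
rewrite ler_pdivlMr ?addr_gt0 // mulrC ler_pdivrMr ?addr_gt0 //.
rewrite mulrDr mulr1 -expRD.
have h1 : 1 <= expR `|d| by rewrite -[X in X <= _]expR0 ler_expR.
have h2 : expR (- x) <= expR (`|d| - (x + d)).
  by rewrite ler_expR; have := ler_norm d; lra.
lra.
Qed.

(** Convexity of the exponential: after division by [expR (p * d)], tangent lines bound both
    exponentials from below and their linear terms cancel. *)
Lemma expR_mul_le p d : 0 <= p <= 1 -> expR (p * d) <= 1 - p + p * expR d.
Proof.
move=> /andP[p0 p1]; have e := expR_gt0 (p * d).
have h1 := expR_ge1Dx ((1 - p) * d); have h2 := expR_ge1Dx (- (p * d)).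
have : 1 <= (1 - p) * expR (- (p * d)) + p * expR ((1 - p) * d).
  by nra.
rewrite -(ler_pM2l e) mulr1 => /le_trans; apply.
rewrite mulrDr ![expR _ * (_ * _)]mulrCA -!expRD subrr expR0 mulr1.
by rewrite (_ : p * d + _ = d) //; ring.
Qed.

(** The function [ln (logistic x)] is concave with derivative [1 - logistic x], so it lies below its
    tangent. Concretely, the ratio is [1 / (p + (1 - p) * expR (- d))], and convexity bounds the
    denominator. *)
Lemma logistic_ratio_true x d :
  logistic (x + d) / logistic x <= expR ((1 - logistic x) * d).
Proof.
set p := logistic x; have p0 : 0 < p := logistic_gt0 x.
have p1 : p < 1 := logistic_lt1 x.
have ex : expR (- x) = (1 - p) / p.
  by rewrite /p /logistic; have := expR_gt0 (- x) => e; field; rewrite gt_eqF ?addr_gt0.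
have -> : logistic (x + d) = p / (p + (1 - p) * expR (- d)).
  rewrite /logistic opprD expRD ex; have := expR_gt0 (- d) => e; field.
  by rewrite !gt_eqF // ?addr_gt0 ?mulr_gt0 // subr_gt0.
have h : 0 < p + (1 - p) * expR (- d) by rewrite addr_gt0 ?mulr_gt0 ?expR_gt0 ?subr_gt0.
rewrite mulrAC divff ?gt_eqF // mul1r -[leRHS]invrK lef_pV2 ?posrE ?invr_gt0 ?expR_gt0 //.
rewrite -expRN -mulrN.
apply: le_trans (expR_mul_le _ _) _; first by apply/andP; split; lra.
by rewrite opprB addrCA subrr addr0.
Qed.

Lemma logistic_ratio_false x d :
  (1 - logistic (x + d)) / (1 - logistic x) <= expR (- logistic x * d).
Proof.
rewrite -!logisticN opprD; have := logistic_ratio_true (- x) (- d).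
by rewrite logisticN opprB addrCA subrr addr0 mulNr mulrN.
Qed.

(* [lam] is the Renyi order, and the penalty [kap] is charged to a true answer only. *)
Lemma logistic_renyi (lam : nat) (kap v x d : R) :
  (0 < lam)%N -> `|d| * lam%:R <= v -> v <= 16^-1 -> kap = 8 * v ^+ 2 ->
  logistic (x + d) * (logistic (x + d) / logistic x) ^+ lam * expR (- kap) +
  (1 - logistic (x + d)) * ((1 - logistic (x + d)) / (1 - logistic x)) ^+ lam <= 1.
Proof.
move=> lam0 dv v16 ek.
set p := logistic (x + d); set q := logistic x.
have p0 : 0 < p := logistic_gt0 _; have p1 : p < 1 := logistic_lt1 _.
have q0 : 0 < q := logistic_gt0 _; have q1 : q < 1 := logistic_lt1 _.
set u := lam%:R * d.
have l1 : 1 <= lam%:R :> R by rewrite ler1n.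
have dn : `|d| <= v by apply: le_trans dv; rewrite ler_peMr.
have un : `|u| <= v by rewrite normrM ger0_norm ?ler0n // mulrC.
have v0 : 0 <= v := le_trans (normr_ge0 _) un.
have h1 : (p / q) ^+ lam <= expR ((1 - q) * u).
  have := lerXn2r lam _ _ (logistic_ratio_true x d).
  by rewrite -expRM_natl mulrCA; apply; rewrite nnegrE ?expR_ge0 // divr_ge0 // ltW.
have h2 : ((1 - p) / (1 - q)) ^+ lam <= expR (- q * u).
  have := lerXn2r lam _ _ (logistic_ratio_false x d).
  by rewrite -expRM_natl mulrCA; apply; rewrite nnegrE ?expR_ge0 // divr_ge0 // subr_ge0 ltW.
(* Factoring out [expR (- q * u)] and using [1 + z <= expR z] reduces the claim to
   [p * (expR (u - kap) - 1) <= q * u]. *)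
apply: (@le_trans _ _ (expR (- q * u) * (1 + p * (expR (u - kap) - 1)))).
  rewrite mulrDr mulr1 mulrBr mulr1.
  have -> : expR (- q * u) + expR (- q * u) * (p * expR (u - kap) - p) =
     p * expR ((1 - q) * u) * expR (- kap) + (1 - p) * expR (- q * u).
    rewrite (_ : (1 - q) * u = - q * u + u); last by ring.
    by rewrite !expRD; ring.
  rewrite lerD // ?ler_wpM2l ?subr_ge0 ?(ltW p1) //.
  by rewrite ler_wpM2r ?expR_ge0 // ler_wpM2l ?(ltW p0).
apply: (@le_trans _ _ (expR (- q * u) * expR (p * (expR (u - kap) - 1)))).
  by rewrite ler_wpM2l ?expR_ge0 // expR_ge1Dx.
rewrite -expRD -[leRHS]expR0 ler_expR mulNr addrC subr_le0.
have eb (y : R) : `|y| <= 2^-1 -> expR y <= 1 + y + 2 * y ^+ 2.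
  move=> yh; have := expR_ge1Dx (- y); rewrite expRN => h.
  have y2 : - 2^-1 <= y <= 2^-1 by rewrite -ler_norml.
  have ey := expR_gt0 y.
  have : (1 - y) * expR y <= 1 by rewrite -ler_pdivlMr // div1r.
  move: y2 => /andP[ya yb] hy.
  have y1 : 0 < 1 - y by lra.
  rewrite -(ler_pM2l y1). apply: (le_trans hy); nra.
have uv : - v <= u <= v by rewrite -ler_norml.
have dv' : - v <= d <= v by rewrite -ler_norml.
move: uv dv' => /andP[uv1 uv2] /andP[dv1 dv2].
have k0 : 0 <= kap <= v / 2 by rewrite ek; apply/andP; split; nra.
move: k0 => /andP[k0 k1].
have e1 : expR (u - kap) - 1 <= u - kap + 2 * (u - kap) ^+ 2.
  by rewrite lerBlDl addrA eb // ler_norml; apply/andP; split; lra.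
have ed : expR `|d| <= 1 + 2 * `|d|.
  apply: le_trans (eb _ _) _; first by rewrite normr_id; lra.
  by have := normr_ge0 d; nra.
have pq1 : p <= (1 + 2 * `|d|) * q.
  by apply: (le_trans (logistic_shift_le _ _)); rewrite ler_wpM2r // ltW.
have pq2 : q <= (1 + 2 * `|d|) * p.
  rewrite /q (_ : x = x + d - d); last by ring.
  apply: (le_trans (logistic_shift_le _ _)); rewrite normrN.
  by rewrite ler_wpM2r // ltW.
have d0 := normr_ge0 d.
have un0 := normr_ge0 u.
(* [p] and [q] differ by a factor at most [1 + 2 |d|], and [|d| |u| <= v^2], so exchanging them
   costs at most [2 v^2 p]. *)
have pu : p * u <= q * u + 2 * v ^+ 2 * p.
  have [u0|u0] := leP 0 u.
    suff : p * u - q * u <= 2 * `|d| * u * p.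
      have : 2 * `|d| * u * p <= 2 * v ^+ 2 * p by rewrite ler_wpM2r ?(ltW p0) //; nra.
      lra.
    have : p - q <= 2 * `|d| * p.
      have [pq|/ltW pq] := leP p q; last by nra.
      by have := mulr_ge0 d0 (ltW p0); lra.
    by move=> h; have := ler_wpM2r u0 h; lra.
  have : q - p <= 2 * `|d| * p by lra.
  move=> h; have u0' : 0 <= - u by lra.
  have := ler_wpM2r u0' h.
  have : 2 * `|d| * p * - u <= 2 * v ^+ 2 * p.
    have -> : 2 * `|d| * p * - u = 2 * (`|d| * - u) * p by ring.
    rewrite ler_wpM2r ?(ltW p0) // expr2 ler_wpM2l //.
    by apply: ler_pM => //; lra.
  lra.
(* From [v <= 1/16] follows [kap <= v / 2], hence [|u - kap| <= 3 v / 2]. The errors then sum to at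
   most [(9/2 + 2) v^2], which [kap = 8 v^2] absorbs. *)
have sq : (u - kap) ^+ 2 <= (3 / 2 * v) ^+ 2.
  by rewrite -ler_sqrt ?sqr_ge0 // !sqrtr_sqr [leRHS]ger0_norm ?ler_norml; [apply/andP; split; lra|lra].
have : p * (expR (u - kap) - 1) <= p * (u - kap + 2 * (u - kap) ^+ 2).
  by rewrite ler_wpM2l // ltW.
have : p * (- kap + 2 * (u - kap) ^+ 2 + 2 * v ^+ 2) <= 0.
  by rewrite mulr_ge0_le0 ?(ltW p0) //; nra.
lra.
Qed.
End Logistic.

(** * Randomised adaptive protocols: privacy and failure probability *)

Section Programs.
Variables (R : realType) (Y : finType).

(* Adaptive protocols asking Boolean questions about a data set; the answers
   are randomised, and biased towards the majority of the entries. *)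
Inductive prog (A : Type) :=
| Ret (a : A)
| Test (h : Y -> bool) (k : bool -> prog A).

Fixpoint bindp A B (t : prog A) (f : A -> prog B) : prog B :=
  match t with
  | Ret a => f a
  | Test h k => Test h (fun b => bindp (k b) f)
  end.

(* [bud Q B D t]: every path of [t] has at most [B] true answers and at most [D]
   answers, and its leaf satisfies [Q] together with the unused allowances. *)
Fixpoint bud A (Q : nat -> nat -> A -> Prop) (B D : nat) (t : prog A) {struct t} : Prop :=
  match t with
  | Ret a => Q B D a
  | Test h k =>
      match B, D with
      | B'.+1, D'.+1 => bud Q B' D' (k true) /\ bud Q B D' (k false)
      | _, _ => False
      end
  end.

Lemma bud_bind A C (Q : nat -> nat -> A -> Prop) (Q' : nat -> nat -> C -> Prop)
    (f : A -> prog C) (t : prog A) B D :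
  (forall B D a, Q B D a -> bud Q' B D (f a)) -> bud Q B D t -> bud Q' B D (bindp t f).
Proof.
move=> hf; elim: t B D => [a|h k IH] B D /=; first exact: hf.
by case: B D => [|B] [|D] // [h1 h2]; split; apply: IH.
Qed.

Variable wrong : (Y -> bool) -> bool -> bool.

(** Correctness along paths free of wrong answers is a deterministic matter; probability enters only
    through [guard]. *)
Fixpoint allok A (Q : A -> Prop) (t : prog A) : Prop :=
  match t with
  | Ret a => Q a
  | Test h k => forall b, ~~ wrong h b -> allok Q (k b)
  end.

Lemma allok_sub A (Q Q' : A -> Prop) (t : prog A) :
  (forall a, Q a -> Q' a) -> allok Q t -> allok Q' t.
Proof.
move=> hQ; elim: t => [a|h k IH] /=; first exact: hQ.
by move=> H b hb; apply: IH; apply: H.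
Qed.

Lemma allok_bind A C (Q : A -> Prop) (Q' : C -> Prop) (f : A -> prog C) (t : prog A) :
  (forall a, Q a -> allok Q' (f a)) -> allok Q t -> allok Q' (bindp t f).
Proof.
move=> hf; elim: t => [a|h k IH] /=; first exact: hf.
by move=> H b hb; apply: IH; apply: H.
Qed.

(** Returning the first wrong answer makes the failing test an output of the protocol, to which the
    privacy bound [ev_renyi] applies. *)
Fixpoint guard A (t : prog A) : prog (option ((Y -> bool) * bool)) :=
  match t with
  | Ret _ => Ret None
  | Test h k => Test h (fun b => if wrong h b then Ret (Some (h, b)) else guard (k b))
  end.

Lemma bud_guard A Q B D (t : prog A) :
  bud Q B D t -> bud (fun _ _ _ => True) B D (guard t).
Proof.
elim: t B D => [a|h k IH] B D //=.
by case: B D => [|B] [|D] // [h1 h2]; split; case: ifP => // _; apply: IH.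
Qed.

Definition failed (o : option ((Y -> bool) * bool)) : bool :=
  if o is Some (h, b) then wrong h b else false.

Variables (G : nat) (sigma : R).
Implicit Types S : {ffun 'I_G -> Y}.

Definition agree S (h : Y -> bool) (b : bool) : R := \sum_j (h (S j) == b)%:R.

(** This is the exponential mechanism: answer [b] has weight proportional to
    [expR (agree S h b / (2 * sigma))]. *)
Definition bitp S (h : Y -> bool) (b : bool) : R := logistic ((agree S h b - G%:R / 2) / sigma).

Lemma agree_negb S h b : agree S h (~~ b) = G%:R - agree S h b.
Proof.
apply/eqP; rewrite eq_sym subr_eq -big_split /= -[X in X%:R]card_ord -sum1_card natr_sum.
by apply/eqP; apply: eq_bigr => j _; case: (h _) b => -[]; rewrite /= ?addr0 ?add0r.
Qed.

Lemma bitp_false S h : bitp S h false = 1 - bitp S h true.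
Proof.
rewrite /bitp -logisticN (agree_negb S h true); congr logistic.
by rewrite -[RHS]mulNr; congr (_ / _); field.
Qed.

Lemma bitp_gt0 S h b : 0 < bitp S h b. Proof. exact: logistic_gt0. Qed.

Lemma bitp_le1 S h b : bitp S h b <= 1. Proof. exact/ltW/logistic_lt1. Qed.

Fixpoint ev A S (t : prog A) (F : A -> R) : R :=
  match t with
  | Ret a => F a
  | Test h k => bitp S h true * ev S (k true) F + bitp S h false * ev S (k false) F
  end.

Lemma ev_bind A C S (t : prog A) (f : A -> prog C) F :
  ev S (bindp t f) F = ev S t (fun a => ev S (f a) F).
Proof. by elim: t => [a|h k IH] //=; rewrite !IH. Qed.

Lemma ev_le A S (t : prog A) F F' : (forall a, F a <= F' a) -> ev S t F <= ev S t F'.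
Proof.
move=> hF; elim: t => [a|h k IH] //=.
by rewrite lerD // ler_wpM2l ?(ltW (bitp_gt0 _ _ _)).
Qed.

Lemma eq_ev A S (t : prog A) F F' : F =1 F' -> ev S t F = ev S t F'.
Proof. by move=> hF; elim: t => [a|h k IH] //=; rewrite !IH. Qed.

Lemma ev_cst A S (t : prog A) c : ev S t (fun=> c) = c.
Proof. by elim: t => [a|h k IH] //=; rewrite !IH bitp_false; ring. Qed.

Lemma ev_ge0 A S (t : prog A) F : (forall a, 0 <= F a) -> 0 <= ev S t F.
Proof. by move=> hF; rewrite -(ev_cst S t 0); apply: ev_le. Qed.

Lemma evZ A S (t : prog A) c F : ev S t (fun a => c * F a) = c * ev S t F.
Proof. by elim: t => [a|h k IH] //=; rewrite !IH; ring. Qed.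

Lemma evD A S (t : prog A) F F' :
  ev S t (fun a => F a + F' a) = ev S t F + ev S t F'.
Proof. by elim: t => [a|h k IH] //=; rewrite !IH; ring. Qed.

Lemma ev_sum A S (t : prog A) (I : finType) (F : I -> A -> R) :
  ev S t (fun a => \sum_i F i a) = \sum_i ev S t (F i).
Proof.
elim: t => [a|h k IH] //=.
by rewrite !IH !mulr_sumr -big_split.
Qed.

(** [t] and [guard t] read the same answers until the first wrong one, and a run without wrong
    answers ends in [Q]. *)
Lemma allok_ev A S (t : prog A) (Q : A -> bool) :
  allok Q t -> 1 - ev S (guard t) (fun o => (failed o)%:R) <= ev S t (fun a => (Q a)%:R).
Proof.
elim: t => [a|h k IH] /=; first by move=> ->; rewrite subr0.
move=> H.
have hb b : 1 - ev S (if wrong h b then Ret (Some (h, b)) else guard (k b))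
      (fun o => (failed o)%:R) <= ev S (k b) (fun a => (Q a)%:R).
  case: ifP => hw /=; first by rewrite hw subrr; apply: ev_ge0.
  by apply: IH; apply: H; rewrite hw.
have h1 := ler_wpM2l (ltW (bitp_gt0 S h true)) (hb true).
have h2 := ler_wpM2l (ltW (bitp_gt0 S h false)) (hb false).
rewrite bitp_false in h2 *; lra.
Qed.

(** A poorly supported answer has logit below [- G / (4 sigma)], hence probability at most [be].
    Each of the at most [D] tests on a path contributes once, since the two agreements sum to [G]
    and cannot both be below [G / 4]. *)
Lemma ev_low_agree A S (t : prog A) B D : 0 < sigma -> bud (fun _ _ _ => True) B D t ->
  ev S (guard t) (fun o => if o is Some (h, b) then
                     (wrong h b && (agree S h b < G%:R / 4))%:R else 0)
  <= D%:R * expR (- (G%:R / (4 * sigma))).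
Proof.
move=> s0; set F := (F in ev S _ F); set be := expR _.
have be0 : 0 <= be := expR_ge0 _.
elim: t B D => [a|h k IH] B D /=; first by rewrite mulr_ge0.
case: B D => [|B] [|D] // [H1 H2].
have hb b B' : bud (fun _ _ _ => True) B' D (k b) ->
   bitp S h b * ev S (if wrong h b then Ret (Some (h, b)) else guard (k b)) F
   <= bitp S h b * (D%:R * be) + (wrong h b && (agree S h b < G%:R / 4))%:R * be.
  move=> H; case: ifP => hw /=; last first.
    by rewrite mul0r addr0 ler_wpM2l ?(IH _ B') // ltW ?bitp_gt0.
  rewrite hw /=; case: ltP => hl /=; last first.
    by rewrite mulr0 mul0r addr0 !mulr_ge0 // ltW ?bitp_gt0.
  rewrite mulr1 mul1r -[leLHS]add0r lerD //.
    by rewrite !mulr_ge0 // ltW ?bitp_gt0.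
  apply: le_trans (logistic_le_expR _) _; rewrite ler_expR.
  rewrite ler_pdivrMr // (_ : - (G%:R / (4 * sigma)) * sigma = - (G%:R / 4)); first by lra.
  by field; rewrite gt_eqF.
apply: le_trans (lerD (hb true _ H1) (hb false _ H2)) _.
have : (wrong h true && (agree S h true < G%:R / 4))%:R +
       (wrong h false && (agree S h false < G%:R / 4))%:R <= 1 :> R.
  rewrite (agree_negb S h true).
  have [lt1|] := boolP (agree S h true < G%:R / 4); last by rewrite andbF add0r lern1 leq_b1.
  rewrite (_ : (G%:R - _ < _) = false) ?andbF ?addr0 ?lern1 ?leq_b1 //.
  by apply/negbTE; rewrite -leNgt; have := ler0n R G; lra.
move/(ler_wpM2r be0); rewrite bitp_false -natr1; lra.
Qed.

Lemma agree_upd S j y h b : `|agree S h b - agree (upd S j y) h b| <= 1.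
Proof.
rewrite -sumrB (bigD1 j) //= big1 => [|i ij]; last by rewrite ffunE (negPf ij) subrr.
by rewrite addr0; do 2 case: (_ == b); rewrite /= ?subrr ?subr0 ?sub0r ?normrN ?normr0 ?normr1.
Qed.

(** [a] and [a'] are the likelihoods of the path so far under [S] and [S']. By [logistic_renyi],
    [(a / a')^lam * expR (kap * B)] is a supermartingale under [S], because each true answer spends
    one unit of [B]. *)
Lemma ev_renyi A S S' (t : prog A) (F : A -> R) B D (lam : nat) (kap a a' : R) :
  (forall h b, `|agree S h b - agree S' h b| <= 1) ->
  (forall x, 0 <= F x <= 1) ->
  0 < sigma -> (0 < lam)%N -> lam%:R / sigma <= 16^-1 -> kap = 8 * (lam%:R / sigma) ^+ 2 ->
  0 < a -> 0 < a' -> bud (fun _ _ _ => True) B D t ->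
  a * ev S t F <= expR 1 * (a' * ev S' t F)
                  + a * (a / a') ^+ lam * expR (- lam%:R + kap * B%:R).
Proof.
move=> hS hF s0 lam0 ls ek.
have k0 : 0 <= kap by rewrite ek mulr_ge0 ?sqr_ge0.
elim: t B D a a' => [x|h k IH] B D a a' a0 a'0 /=.
  move=> _; have /andP[F0 F1] := hF x.
  have r0 : 0 < a / a' by rewrite divr_gt0.
  (* Either the likelihood ratio is at most [expR 1], or its [lam]-th power times [expR (- lam)] is
     at least 1 and the error term alone suffices. *)
  have [le|gt] := leP a (expR 1 * a').
    rewrite -[leLHS]addr0 lerD //.
      by rewrite mulrA ler_wpM2r.
    by rewrite !mulr_ge0 ?expR_ge0 ?exprn_ge0 // ltW.
  rewrite -[leLHS]add0r lerD //.
    by rewrite !mulr_ge0 ?expR_ge0 // ltW.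
  rewrite -mulrA ler_wpM2l ?(ltW a0) //; apply: (le_trans F1).
  apply: (@le_trans _ _ ((a / a') ^+ lam * expR (- lam%:R))).
    rewrite expRN -(mulr1 lam%:R) expRM_natl ler_pdivlMr ?exprn_gt0 ?expR_gt0 // mul1r.
    by rewrite lerXn2r ?nnegrE ?expR_ge0 ?(ltW r0) // ler_pdivlMr // ltW.
  by rewrite ler_wpM2l ?exprn_ge0 ?(ltW r0) // ler_expR lerDl mulr_ge0.
case: B D => [|B] [|D] // [H1 H2].
have hp b : 0 < bitp S h b := bitp_gt0 _ _ _.
have hp' b : 0 < bitp S' h b := bitp_gt0 _ _ _.
have := IH true B D (a * bitp S h true) (a' * bitp S' h true)
  (mulr_gt0 a0 (hp _)) (mulr_gt0 a'0 (hp' _)) H1.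
have := IH false B.+1 D (a * bitp S h false) (a' * bitp S' h false)
  (mulr_gt0 a0 (hp _)) (mulr_gt0 a'0 (hp' _)) H2.
set d := (agree S h true - agree S' h true) / sigma.
set x := (agree S' h true - G%:R / 2) / sigma.
have ex : bitp S h true = logistic (x + d).
  by congr logistic; rewrite /x /d -mulrDl; congr (_ / _); ring.
have := @logistic_renyi R lam kap (lam%:R / sigma) x d lam0 _ ls ek.
rewrite -ex -[logistic x]/(bitp S' h true) -!bitp_false.
set p := bitp S h true; set q := bitp S h false.
set p' := bitp S' h true; set q' := bitp S' h false.
move=> /(_ _) hr h2 h1.
have {}hr : p * (p / p') ^+ lam * expR (- kap) + q * (q / q') ^+ lam <= 1.
  apply: hr; rewrite /d normrM normfV (gtr0_norm s0) -mulrA [_^-1 * _]mulrC.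
  by rewrite ler_piMl // divr_ge0 // ltW.
set c := a * (a / a') ^+ lam * expR (- lam%:R + kap * B.+1%:R).
have c0 : 0 <= c by rewrite !mulr_ge0 ?expR_ge0 ?exprn_ge0 ?divr_ge0 ?ltW.
have := ler_wpM2l c0 hr; rewrite mulr1 => hc.
have e1 : a * p * (a * p / (a' * p')) ^+ lam * expR (- lam%:R + kap * B%:R) =
          c * (p * (p / p') ^+ lam * expR (- kap)).
  rewrite /c (_ : - lam%:R + kap * B%:R = - lam%:R + kap * B.+1%:R + - kap); last first.
    by rewrite -natr1; ring.
  by rewrite [in LHS]expRD -mulf_div exprMn; ring.
have e2 : a * q * (a * q / (a' * q')) ^+ lam * expR (- lam%:R + kap * B.+1%:R) =
          c * (q * (q / q') ^+ lam).
  by rewrite /c -mulf_div exprMn; ring.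
rewrite e1 in h1; rewrite e2 in h2.
lra.
Qed.

Variable P : Y -> R.
Hypothesis P0 : forall y, 0 <= P y.
Hypothesis P1 : \sum_y P y = 1.
Hypothesis wrongP : forall h b, wrong h b -> \sum_(y | h y == b) P y <= 100^-1.

Definition fail_prob A (t : prog A) : R :=
  \sum_S prodw P S * ev S (guard t) (fun o => (failed o)%:R).

Definition hit (y : Y) (o : option ((Y -> bool) * bool)) : R :=
  if o is Some (h, b) then (wrong h b && (h y == b))%:R else 0.

Lemma hit01 y o : 0 <= hit y o <= 1.
Proof. by rewrite /hit; case: o => [[h b]|]; rewrite ?lexx ?ler01 // ler0n lern1 leq_b1. Qed.

(* The wrong test found by [guard] is nearly independent of each single entry, by
   [ev_renyi], so few entries can support its answer. *)
Lemma hit_le A (t : prog A) B D (lam : nat) (kap : R) j :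
  0 < sigma -> (0 < lam)%N -> lam%:R / sigma <= 16^-1 -> kap = 8 * (lam%:R / sigma) ^+ 2 ->
  bud (fun _ _ _ => True) B D t ->
  \sum_S prodw P S * ev S (guard t) (hit (S j)) <=
  25^-1 * fail_prob t + expR (- lam%:R + kap * B%:R).
Proof.
move=> s0 lam0 ls ek /bud_guard bt; set d0 := expR _.
pose E (S : {ffun 'I_G -> Y}) y := ev S (guard t) (hit y).
have w0 (S : {ffun 'I_G -> Y}) : 0 <= prodw P S by apply: prodw_ge0.
have e4 := @expR1_le4 R.
have step S y : E S (S j) <= 4 * E (upd S j y) (S j) + d0.
  have := @ev_renyi _ S (upd S j y) (guard t) (hit (S j)) B D lam kap 1 1
     (fun h b => agree_upd S j y h b) (hit01 (S j)) s0 lam0 ls ek ltr01 ltr01 bt.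
  rewrite !mul1r invr1 expr1n mul1r => /le_trans; apply.
  by rewrite lerD2r ler_wpM2r // ev_ge0 // => o; have /andP[] := hit01 (S j) o.
have -> : \sum_S prodw P S * ev S (guard t) (hit (S j)) =
          \sum_S \sum_y prodw P S * P y * E S (S j).
  apply: eq_bigr => S _; rewrite -mulr_suml -mulr_sumr P1 mulr1 //.
apply: (@le_trans _ _ (\sum_S \sum_y prodw P S * P y * (4 * E (upd S j y) (S j) + d0))).
  by apply: ler_sum => S _; apply: ler_sum => y _; rewrite ler_wpM2l // mulr_ge0.
have -> : \sum_S \sum_y prodw P S * P y * (4 * E (upd S j y) (S j) + d0) =
          4 * (\sum_S \sum_y prodw P S * P y * E (upd S j y) (S j)) + d0.
  rewrite mulr_sumr; transitivity
    (\sum_S (4 * (\sum_y prodw P S * P y * E (upd S j y) (S j)) + prodw P S * d0)).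
    apply: eq_bigr => S _.
    transitivity (\sum_y (4 * (prodw P S * P y * E (upd S j y) (S j)) + prodw P S * P y * d0)).
      by apply: eq_bigr => y _; ring.
    by rewrite big_split /= -mulr_sumr -mulr_suml -mulr_sumr P1 mulr1.
  by rewrite big_split /= -[in X in _ + X]mulr_suml prodw_sum1 // mul1r.
(* After the exchange the tested entry is fresh, so it supports a wrong answer with probability at
   most 1/100; the privacy factor [expR 1 <= 4] makes this 1/25. *)
rewrite lerD2r -(prodw_resample P j E) /fail_prob !mulr_sumr; apply: ler_sum => S _.
rewrite (_ : \sum_y prodw P S * P y * E S y = prodw P S * \sum_y P y * E S y); last first.
  by rewrite mulr_sumr; apply: eq_bigr => y _; rewrite mulrA.
rewrite !(mulrCA _ (prodw P S)) ler_wpM2l //.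
have -> : \sum_y P y * E S y = ev S (guard t) (fun o => \sum_y P y * hit y o).
  by rewrite ev_sum; apply: eq_bigr => y _; rewrite evZ.
rewrite -!evZ; apply: ev_le => -[[h b]|] /=; last first.
  by rewrite big1 ?mulr0 // => y _; rewrite mulr0.
case hw: (wrong h b) => /=; last by rewrite big1 ?mulr0 // => y _; rewrite mulr0.
have := wrongP hw; rewrite big_mkcond /=.
rewrite (eq_bigr (fun y => P y * (h y == b)%:R)); first by lra.
by move=> y _; case: eqP; rewrite ?mulr1 ?mulr0.
Qed.

(** Double counting of the entries that support the wrong answer: their expected number is at most
    [G (fail / 25 + d0)] by [hit_le], and each failure outside the low-agreement event has at least
    [G / 4] of them. Solving for [fail] gives the constants 25/21 and 100/21, both below 5. *)
Lemma fail_le_private A (t : prog A) B D (lam : nat) (kap : R) : (0 < G)%N ->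
  0 < sigma -> (0 < lam)%N -> lam%:R / sigma <= 16^-1 -> kap = 8 * (lam%:R / sigma) ^+ 2 ->
  bud (fun _ _ _ => True) B D t ->
  fail_prob t <= 5 * (D%:R * expR (- (G%:R / (4 * sigma))) + expR (- lam%:R + kap * B%:R)).
Proof.
move=> G0 s0 lam0 ls ek bt; set be := expR (- (G%:R / _)); set d0 := expR _.
have w0 (S : {ffun 'I_G -> Y}) : 0 <= prodw P S by apply: prodw_ge0.
have G0' : 0 < G%:R :> R by rewrite ltr0n.
have up : \sum_(j < G) \sum_S prodw P S * ev S (guard t) (hit (S j)) <=
          G%:R * (25^-1 * fail_prob t + d0).
  rewrite -[X in X%:R]card_ord -sum1_card natr_sum mulr_suml; apply: ler_sum => j _.
  by rewrite mul1r; apply: hit_le ls ek bt.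
have low : G%:R / 4 * (fail_prob t - D%:R * be) <=
           \sum_(j < G) \sum_S prodw P S * ev S (guard t) (hit (S j)).
  rewrite exchange_big /= /fail_prob.
  have -> : D%:R * be = \sum_(S : {ffun 'I_G -> Y}) prodw P S * (D%:R * be).
    by rewrite -mulr_suml prodw_sum1 // mul1r.
  rewrite -sumrB mulr_sumr.
  apply: ler_sum => S _; rewrite -mulr_sumr -mulrBr mulrCA ler_wpM2l // -ev_sum.
  have := @ev_low_agree _ S t B D s0 bt; rewrite -/be; set F := (F in ev S _ F) => hl.
  apply: (@le_trans _ _ (G%:R / 4 * (ev S (guard t) (fun o => (failed o)%:R) - ev S (guard t) F))).
    by rewrite ler_wpM2l ?lerD2l ?lerN2 // divr_ge0 // ltW.
  rewrite -[X in _ - X]mul1r -[X in _ + X]mulNr -evZ -evD -evZ; apply: ev_le => -[[h b]|] /=.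
    rewrite /hit; case hw: (wrong h b) => /=; last by rewrite big1 //; lra.
    rewrite -/(agree S h b); case: ltP => hlt /=; last by lra.
    by rewrite (_ : _ * _ = 0) ?sumr_ge0 //; ring.
  by rewrite big1 //; lra.
have := le_trans low up; rewrite -ler_pdivlMl ?divr_gt0 // invf_div.
rewrite (mulrA (4 / G%:R)) divfK ?gt_eqF // => hh.
have be0 : 0 <= be := expR_ge0 _; have d00 : 0 <= d0 := expR_ge0 _.
have db0 : 0 <= D%:R * be by rewrite mulr_ge0.
lra.
Qed.

(** Chernoff bound: the probability is at most [expR (agree - G / 2)], whose mean factors over the
    entries. Each factor is at most [1 + (e - 1) / 100 <= expR (3 / 100)], and
    [1/2 - 3/100 >= 2/5]. *)
Lemma bitp_wrong_le h b : sigma = 1 -> wrong h b ->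
  \sum_S prodw P S * bitp S h b <= expR (- (2 / 5 * G%:R)).
Proof.
move=> s1 hw.
apply: (@le_trans _ _ (\sum_S prodw P S * (expR (- (G%:R / 2)) * \prod_j expR (h (S j) == b)%:R))).
  apply: ler_sum => S _; rewrite ler_wpM2l ?prodw_ge0 //.
  rewrite /bitp s1 divr1; apply: le_trans (logistic_le_expR _) _.
  by rewrite -expR_sum -expRD ler_expR addrC.
rewrite (eq_bigr (fun S => expR (- (G%:R / 2)) * (prodw P S * \prod_j expR (h (S j) == b)%:R))); last first.
  by move=> S _; rewrite mulrCA.
rewrite -mulr_sumr (prodw_prod P (fun _ y => expR (h y == b)%:R)).
rewrite prodr_const card_ord.
have e4 := @expR1_le4 R.
have hq : \sum_y P y * expR (h y == b)%:R <= expR (3 / 100).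
  apply: (@le_trans _ _ (1 + 3 / 100)); last exact: expR_ge1Dx.
  rewrite (eq_bigr (fun y => P y + (expR 1 - 1) * (if h y == b then P y else 0))); last first.
    by move=> y _; case: eqP => _; rewrite ?expR0; ring.
  rewrite big_split /= P1 -mulr_sumr -big_mkcond /= lerD2l.
  have := wrongP hw => hw'; have e1 := expR_ge1Dx (1 : R).
  have s0 : 0 <= \sum_(y | h y == b) P y by apply: sumr_ge0.
  nra.
apply: (@le_trans _ _ (expR (- (G%:R / 2)) * expR (3 / 100) ^+ G)).
  rewrite ler_wpM2l ?expR_ge0 // lerXn2r ?nnegrE ?expR_ge0 //.
  by apply: sumr_ge0 => y _; rewrite mulr_ge0 ?expR_ge0.
rewrite -expRM_natl -expRD ler_expR; have := ler0n R G; lra.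
Qed.

(** Union bound over the ways to reach a wrong answer, counted through
    [(D+1)^B + (D+1)^(B+1) <= (D+2)^(B+1)]. *)
Lemma fail_le_union A (t : prog A) B D : sigma = 1 -> bud (fun _ _ _ => True) B D t ->
  fail_prob t <= D.+1%:R ^+ B * expR (- (2 / 5 * G%:R)).
Proof.
move=> s1 bt; set be := expR _; have be0 : 0 <= be := expR_ge0 _.
have w0 (S : {ffun 'I_G -> Y}) : 0 <= prodw P S by apply: prodw_ge0.
(* The weight [a] carries the probability of the earlier answers, which depends on [S]; at a wrong
   answer it is bounded by 1. *)
suff gen (a : {ffun 'I_G -> Y} -> R) : (forall S, 0 <= a S <= 1) ->
   \sum_S prodw P S * (a S * ev S (guard t) (fun o => (failed o)%:R)) <= D.+1%:R ^+ B * be.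
  have := gen (fun=> 1); under eq_bigr do rewrite mul1r; apply => S.
  by rewrite ler01 lexx.
elim: t B D bt a => [x|h k IH] B D /=.
  move=> _ a ha; rewrite big1 ?mulr_ge0 ?exprn_ge0 // => S _; rewrite !mulr0 //.
case: B D => [|B] [|D] // [H1 H2] a ha.
have c0 n m : 1 <= n.+1%:R ^+ m :> R by rewrite exprn_ege1 // ler1n.
have hb b B' : bud (fun _ _ _ => True) B' D (k b) ->
   \sum_S prodw P S * (a S * bitp S h b *
     ev S (if wrong h b then Ret (Some (h, b)) else guard (k b)) (fun o => (failed o)%:R))
   <= D.+1%:R ^+ B' * be.
  move=> H; have hab S : 0 <= a S * bitp S h b <= 1.
    have /andP[a0 a1] := ha S; have b0 := bitp_gt0 S h b.
    by rewrite mulr_ge0 ?(ltW b0) //= mulr_ile1 ?(ltW b0) ?bitp_le1.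
  case: ifP => hw /=; last by apply: IH.
  rewrite hw; apply: (@le_trans _ _ be); last by rewrite ler_peMl.
  apply: le_trans (bitp_wrong_le s1 hw); apply: ler_sum => S _.
  rewrite ler_wpM2l // mulr1 ler_piMl ?(ltW (bitp_gt0 _ _ _)) //.
  by have /andP[] := ha S.
have := lerD (hb true _ H1) (hb false _ H2).
rewrite -big_split /= (eq_bigr (fun S => prodw P S * (a S *
  (bitp S h true * ev S (if wrong h true then Ret (Some (h, true)) else guard (k true)) (fun o => (failed o)%:R)
  + bitp S h false * ev S (if wrong h false then Ret (Some (h, false)) else guard (k false)) (fun o => (failed o)%:R))))); last first.
  by move=> S _; ring.
move=> /le_trans; apply; rewrite -mulrDl ler_wpM2r //.
rewrite -!natrX -natrD ler_nat [in leqRHS]expnS mulSn [(D.+1 ^ B.+1)%N]expnS.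
have le : (D.+1 ^ B <= D.+2 ^ B)%N by case: (B) => // n; rewrite leq_exp2r.
by rewrite leq_add // leq_mul.
Qed.

End Programs.

(** * Quantum implementation of a classical randomised response to single-copy measurements *)

Section Simulation.
Variable R : realType.
Local Notation C := R[i].

Variables (d N L : nat) (X : finType) (g : X -> 'cV[C]_d).
Local Notation data := {ffun 'I_N -> X}.
Variables (p : data -> history R d -> 'cV[C]_d -> 'I_L -> R)
          (est : history R d -> 'cV[C]_d -> 'I_L -> R).

Hypothesis povm : forall a b, \sum_x g x a 0 * conjc (g x b 0) = (a == b)%:R.
Hypothesis p_ge0 : forall s h psi o, 0 <= p s h psi o.
Hypothesis p_sum1 : forall s h psi, \sum_o p s h psi o = 1.

Definition born (rho : 'M[C]_d) (x : X) : R :=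
  complex.Re ((mxadj (g x) *m rho *m g x) 0 0).

Definition measure_amp (s : data) (f : {ffun 'I_N -> 'I_d}) : C :=
  \prod_k g (s k) (f k) 0.

(* The memory holds the measured data [s] as a classical register, which the
   later rounds consult through diagonal operators without disturbing it. *)
Definition simulation : algorithm R d N #|{: data}| L #|{: data}| :=
  Algorithm
    (fun l => \matrix_(i, j) ((i == l)%:R *
       conjc (measure_amp (enum_val l) (enum_val j : {ffun 'I_N -> 'I_d}))))
    (fun h psi o l => diag_mx (\row_j
       (if j == l then (Num.sqrt (p (enum_val l) h psi o))%:C else 0)%C))
    est.

Lemma measure_amp_complete (f f' : {ffun 'I_N -> 'I_d}) :
  \sum_s measure_amp s f * conjc (measure_amp s f') = (f == f')%:R.
Proof.
rewrite /measure_amp.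
under eq_bigr do rewrite rmorph_prod -big_split /=.
rewrite -(bigA_distr_bigA (fun k x => g x (f k) 0 * conjc (g x (f' k) 0))).
under eq_bigr do rewrite povm.
case: eqP => [-> | /eqP neq]; first by rewrite big1 // => k _; rewrite eqxx.
have [k hk] : exists k, f k != f' k.
  apply/existsP; apply: contraNT neq; rewrite negb_exists => /forallP h.
  by apply/eqP/ffunP => k; apply/eqP; have := h k; rewrite negbK.
by rewrite (bigD1 k) //= (negPf hk) mul0r.
Qed.

Lemma mxadj_diag_real n (w : 'I_n -> R) :
  mxadj (diag_mx (\row_j ((w j)%:C)%C)) = diag_mx (\row_j ((w j)%:C)%C).
Proof.
apply/matrixP => i j; rewrite !mxE rmorphMn /= oppr0.
by case: eqP => [->|]; rewrite ?eqxx // eq_sym => /eqP/negPf ->.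
Qed.

Lemma simulation_valid : valid_algorithm simulation.
Proof.
split=> [|h psi].
  apply/matrixP => j j'; rewrite summxE !mxE.
  transitivity (\sum_(s : data) measure_amp s (enum_val j) * conjc (measure_amp s (enum_val j'))).
    rewrite (reindex (@enum_val _ {: data})) /=; last by apply: onW_bij; apply: enum_val_bij.
    apply: eq_bigr => l _; rewrite !mxE (bigD1 l) //= big1 => [|i /negPf il].
      by rewrite !mxE eqxx !mul1r conjcK addr0.
    by rewrite !mxE il !mul0r conjc0 mul0r.
  by rewrite measure_amp_complete (inj_eq enum_val_inj).
apply/matrixP => i j; rewrite summxE.
transitivity (\sum_(o < L) ((i == j)%:R * (p (enum_val i) h psi o)%:C)%C).
  apply: eq_bigr => o _; rewrite summxE (bigD1 i) //= big1 => [|l /negPf li].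
    rewrite (_ : (fun j => if j == i then _ else _) = (fun j => ((if j == i then Num.sqrt (p (enum_val i) h psi o) else 0)%:C)%C)); last first.
      by apply/funext => k; case: eqP.
    rewrite mxadj_diag_real mulmx_diag !mxE eqxx addr0 -rmorphM -expr2 sqr_sqrtr //.
    by rewrite mulr_natl.
  rewrite (_ : (fun j => if j == l then _ else _) = (fun j => ((if j == l then Num.sqrt (p (enum_val l) h psi o) else 0)%:C)%C)); last first.
    by apply/funext => k; case: eqP.
  by rewrite mxadj_diag_real mulmx_diag !mxE eq_sym li mul0r mul0rn.
rewrite -mulr_sumr -rmorph_sum /= p_sum1 rmorph1 mulr1 !mxE.
by case: eqP.
Qed.

Variables (rho : 'M[C]_d) (A : history R d -> 'cV[C]_d) (eps : R).

Fixpoint answers_ok (m : nat) (h : history R d) (s : data) : R :=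
  match m with
  | 0 => 1
  | m'.+1 => \sum_(o < L)
      (if `|est h (A h) o - expval rho (A h)| <= eps
       then p s h (A h) o * answers_ok m' (rcons h (A h, est h (A h) o)) s else 0)
  end.

(** The memory stays diagonal: an instrument only rescales the weight of record [s] by [p s], so the
    quantum weights reduce to classical expectations. *)
Lemma success_weight_simulation m h (w : data -> R) :
  success_weight rho simulation A eps m h
    (diag_mx (\row_l ((w (enum_val l))%:C)%C)) =
  ((\sum_s w s * answers_ok m h s)%:C)%C.
Proof.
elim: m h w => [|m IH] h w /=.
  rewrite mxtrace_diag rmorph_sum (reindex (@enum_val _ {: data})) /=; last first.
    by apply: onW_bij; apply: enum_val_bij.
  by apply: eq_bigr => l _; rewrite mxE mulr1.
under [in RHS]eq_bigr do rewrite mulr_sumr.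
rewrite exchange_big rmorph_sum /=; apply: eq_bigr => o _.
case: ifP => _; last first.
  by rewrite big1 // => s _; rewrite mulr0.
rewrite (_ : \sum_l _ = diag_mx (\row_l ((w (enum_val l) * p (enum_val l) h (A h) o)%:C)%C)).
  rewrite (IH _ (fun s => w s * p s h (A h) o)).
  by congr (_%:C)%C; apply: eq_bigr => s _; rewrite mulrA.
apply/matrixP => i j; rewrite summxE (bigD1 i) //= big1 => [|l /negPf li].
  rewrite (_ : (fun j => if j == i then _ else _) = (fun j => ((if j == i then Num.sqrt (p (enum_val i) h (A h) o) else 0)%:C)%C)); last first.
    by apply/funext => k; case: eqP.
  rewrite mxadj_diag_real !mulmx_diag !mxE eqxx addr0 -!rmorphM mulrAC -expr2 sqr_sqrtr //.
  by rewrite mulrC.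
rewrite (_ : (fun j => if j == l then _ else _) = (fun j => ((if j == l then Num.sqrt (p (enum_val l) h (A h) o) else 0)%:C)%C)); last first.
  by apply/funext => k; case: eqP.
by rewrite mxadj_diag_real !mulmx_diag !mxE eq_sym li !mul0r mul0rn.
Qed.

Lemma success_prob_simulation m : density_matrix rho ->
  success_prob rho simulation A eps m =
  ((\sum_s prodw (born rho) s * answers_ok m [::] s)%:C)%C.
Proof.
move=> [_ pos _]; rewrite -success_weight_simulation /success_prob; congr success_weight.
apply/matrixP => i i'; rewrite summxE.
have bornE x : ((born rho x)%:C)%C = (mxadj (g x) *m rho *m g x) 0 0.
  by rewrite RRe_real // ger0_real.
(* The form of the tensor power at a product vector factors over the copies, which gives record [s]
   its product Born probability. *)
have key (s : data) : \sum_(j < copies_dim d N) \sum_(j' < copies_dim d N)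
    conjc (measure_amp s (enum_val j)) * tens_pow N rho j j' * measure_amp s (enum_val j') =
    ((prodw (born rho) s)%:C)%C.
  rewrite rmorph_prod /=.
  transitivity (\prod_k \sum_a \sum_b conjc (g (s k) a 0) * rho a b * g (s k) b 0); last first.
    apply: eq_bigr => k _; rewrite bornE mxE exchange_big /=; apply: eq_bigr => b _.
    rewrite mxE mulr_suml; apply: eq_bigr => a _.
    by rewrite !mxE.
  rewrite bigA_distr_bigA /=.
  rewrite [RHS](reindex (@enum_val _ {: {ffun 'I_N -> 'I_d}})) /=; last first.
    by apply: onW_bij; apply: enum_val_bij.
  apply: eq_bigr => j _; rewrite bigA_distr_bigA /=.
  rewrite [RHS](reindex (@enum_val _ {: {ffun 'I_N -> 'I_d}})) /=; last first.
    by apply: onW_bij; apply: enum_val_bij.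
  apply: eq_bigr => j' _; rewrite mxE /measure_amp rmorph_prod -!big_split /=.
  by [].
transitivity (\sum_l ((i == l)%:R * (i' == l)%:R * (prodw (born rho) (enum_val l))%:C)%C).
  apply: eq_bigr => l _; rewrite -key exchange_big mulr_sumr mxE /=.
  apply: eq_bigr => j' _; rewrite mxE mulr_suml mulr_sumr; apply: eq_bigr => j _.
  by rewrite !mxE rmorphM /= conjcK conjc_nat; ring.
rewrite (bigD1 i) //= big1 => [|l /negPf li]; last by rewrite eq_sym li !mul0r.
by rewrite !mxE eqxx mul1r addr0 eq_sym mulr_natl.
Qed.
End Simulation.

(** * Moments of the random measurement vectors *)

Section Ensemble.
Variable R : realType.
Local Notation C := R[i].

(* The amplitude is [0] with probability 1/2 and each of [+-1 +-i] with probability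
   1/8, which matches the moments of a complex Gaussian up to order 4. The last bit
   is idle: it makes the alphabet size a perfect square. *)
Definition alphabet : finType := (bool * bool * bool * bool)%type.

Definition amp (a : alphabet) : C :=
  let: (b0, b1, b2, _) := a in
  if b0 then Complex ((-1) ^+ b1) ((-1) ^+ b2) else 0.

Lemma sum_alphabet (V : nmodType) (f : alphabet -> V) :
  \sum_a f a = \sum_b0 \sum_b1 \sum_b2 \sum_b3 f (b0, b1, b2, b3).
Proof.
rewrite !pair_big /=; apply: eq_bigr => -[[[b0 b1] b2] b3] _ //.
Qed.

(** The mean of a product of at most two conjugated and two plain factors of one letter, as for a
    standard complex Gaussian: absolute moments 1 and 2, and 0 for unbalanced products. *)
Definition amp_moment (b1 b2 b3 b4 : bool) : nat :=
  if (b1 + b3 == b2 + b4)%N then (if b1 && b3 then 2 else 1)%N else 0%N.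

Lemma sum_amp (b1 b2 b3 b4 : bool) :
  \sum_a (if b1 then conjc (amp a) else 1) * (if b2 then amp a else 1) *
         (if b3 then conjc (amp a) else 1) * (if b4 then amp a else 1) =
  (16 * amp_moment b1 b2 b3 b4)%:R.
Proof.
rewrite sum_alphabet !big_bool /=.
case: b1 b2 b3 b4 => -[] [] []; rewrite /amp_moment /= ?mul1r ?mulr1 ?mul0r ?mulr0 ?addr0 ?add0r;
  last by ring.
all: rewrite -(rmorph_nat (real_complex R)); apply/eqP; rewrite eq_complex /=.
all: rewrite ?mulr0n; apply/andP; split; apply/eqP; try ring.
Qed.

Variable d : nat.
Local Notation X := {ffun 'I_d -> alphabet}.

(** Wick's formula: one summand for each pairing of conjugated with plain indices. Both pairings
    hold when all four indices coincide, in accordance with the fourth moment 2. *)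
Lemma prod_amp_moment (i j k l : 'I_d) :
  (\prod_v amp_moment (v == i) (v == j) (v == k) (v == l) =
  ((i == j) && (k == l)) + ((i == l) && (j == k)))%N.
Proof.
have zero v : amp_moment (v == i) (v == j) (v == k) (v == l) = 0%N ->
   (\prod_v amp_moment (v == i) (v == j) (v == k) (v == l) = 0)%N.
  by move=> h; rewrite (bigD1 v) //= h mul0n.
have [ij|ij] := eqVneq i j.
  have [kl|kl] := eqVneq k l; last first.
    rewrite (zero k) -?ij; last by rewrite eqxx (negPf kl) /amp_moment; case: (k == i).
    by case: eqP => //= ->; rewrite eq_sym (negPf kl).
  rewrite -ij -kl andbb /=; have [ik|ik] := eqVneq i k.
    rewrite -ik (bigD1 i) //= big1 ?eqxx // => v /negPf ->; by [].
  rewrite big1 // => v _; rewrite /amp_moment; have [->|] := eqVneq v i; last by case: (v == k).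
  by rewrite (negPf ik).
have [il|il] := eqVneq i l; last first.
  by rewrite (zero i) // eqxx (negPf ij) (negPf il) /amp_moment; case: (i == k).
have [jk|jk] := eqVneq j k; last first.
  by rewrite (zero j) // eqxx eq_sym (negPf ij) (negPf jk) /amp_moment; case: (j == l).
rewrite -il -jk big1 // => v _; rewrite /amp_moment.
have [->|] := eqVneq v i; last by case: (v == j).
by rewrite (negPf ij).
Qed.

Lemma sum_amp4 (i j k l : 'I_d) :
  \sum_(x : X) conjc (amp (x i)) * amp (x j) * conjc (amp (x k)) * amp (x l) =
  (16 ^ d * (((i == j) && (k == l)) + ((i == l) && (j == k))))%N%:R.
Proof.
pose F v (a : alphabet) := (if v == i then conjc (amp a) else 1) *
  (if v == j then amp a else 1) * (if v == k then conjc (amp a) else 1) *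
  (if v == l then amp a else 1).
transitivity (\sum_(x : X) \prod_v F v (x v)).
  by apply: eq_bigr => x _; rewrite !big_split /= -!big_mkcond !big_pred1_eq.
rewrite -bigA_distr_bigA /=.
rewrite (eq_bigr (fun v => (16 * amp_moment (v == i) (v == j) (v == k) (v == l))%:R)); last first.
  move=> v _. exact (sum_amp (v == i) (v == j) (v == k) (v == l)).
rewrite -natr_prod; congr (_%:R).
by rewrite big_split /= prod_nat_const card_ord prod_amp_moment.
Qed.

Lemma sum_amp2 (i j : 'I_d) :
  \sum_(x : X) amp (x i) * conjc (amp (x j)) = (16 ^ d * (i == j))%N%:R.
Proof.
pose F v (a : alphabet) := (if v == j then conjc (amp a) else 1) *
  (if v == i then amp a else 1) * (if false then conjc (amp a) else 1) *
  (if false then amp a else 1).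
transitivity (\sum_(x : X) \prod_v F v (x v)).
  apply: eq_bigr => x _; rewrite !big_split /= -!big_mkcond !big_pred1_eq.
  by rewrite !big1 // !mulr1 mulrC.
rewrite -bigA_distr_bigA /=.
rewrite (eq_bigr (fun v => (16 * amp_moment (v == j) (v == i) false false)%:R)); last first.
  by move=> v _; exact (sum_amp (v == j) (v == i) false false).
rewrite -natr_prod; congr (_%:R).
rewrite big_split /= prod_nat_const card_ord; congr (_ * _)%N.
have [<-|ij] := eqVneq i j; first by rewrite big1 // => v _; case: (v == i).
by rewrite (bigD1 i) //= eqxx (negPf ij) mul0n.
Qed.

Definition qform (A : 'M[C]_d) (x : X) : C :=
  \sum_i \sum_j conjc (amp (x i)) * A i j * amp (x j).

(** The pairing [i = j], [k = l] gives the product of the traces, and [i = l], [j = k] the trace of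
    the product. *)
Lemma sum_qform2 (A B : 'M[C]_d) :
  \sum_(x : X) qform A x * qform B x =
  (16 ^ d)%N%:R * (\tr A * \tr B + \tr (A *m B)).
Proof.
transitivity (\sum_i \sum_j \sum_k \sum_l A i j * B k l *
  \sum_(x : X) conjc (amp (x i)) * amp (x j) * conjc (amp (x k)) * amp (x l)).
  rewrite /qform; under eq_bigr do rewrite big_distrlr /=.
  rewrite exchange_big; apply: eq_bigr => i _ /=.
  transitivity (\sum_k \sum_j \sum_(x : X) \sum_l (conjc (amp (x i)) * A i j * amp (x j) *
     (conjc (amp (x k)) * B k l * amp (x l)))).
    rewrite exchange_big; apply: eq_bigr => k _ /=; rewrite exchange_big /=.
    by apply: eq_bigr => x _; rewrite big_distrlr.
  rewrite exchange_big; apply: eq_bigr => j _; apply: eq_bigr => k _ /=.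
  rewrite exchange_big; apply: eq_bigr => l _ /=.
  by rewrite mulr_sumr; apply: eq_bigr => x _; ring.
under eq_bigr do under eq_bigr do under eq_bigr do under eq_bigr do rewrite sum_amp4 natrM natrD mulrCA mulrDr.
have E (F : 'I_d -> 'I_d -> 'I_d -> 'I_d -> C) :
   \sum_i \sum_j \sum_k \sum_l (16 ^ d)%N%:R * F i j k l = (16 ^ d)%N%:R * \sum_i \sum_j \sum_k \sum_l F i j k l.
  by rewrite mulr_sumr; apply: eq_bigr => i _; rewrite mulr_sumr; apply: eq_bigr => j _;
     rewrite mulr_sumr; apply: eq_bigr => k _; rewrite mulr_sumr.
rewrite E; congr (_ * _).
under eq_bigr do under eq_bigr do under eq_bigr do rewrite big_split /=.
under eq_bigr do under eq_bigr do rewrite big_split /=.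
under eq_bigr do rewrite big_split /=.
rewrite big_split /=; congr (_ + _).
  rewrite /mxtrace mulr_suml; apply: eq_bigr => i _.
  rewrite (bigD1 i) //= [X in _ + X]big1 ?addr0 => [|j /negPf ji]; last first.
    by rewrite big1 // => k _; rewrite big1 // => l _; rewrite eq_sym ji mulr0.
  rewrite mulr_sumr; apply: eq_bigr => k _.
  rewrite (bigD1 k) //= big1 ?addr0 => [|l /negPf lk]; last first.
    by rewrite [k == l]eq_sym lk andbF mulr0.
  by rewrite !eqxx mulr1.
rewrite /mxtrace; apply: eq_bigr => i _; rewrite mxE; apply: eq_bigr => j _.
rewrite (bigD1 j) //= [X in _ + X]big1 ?addr0 => [|k /negPf kj]; last first.
  by rewrite big1 // => l _; rewrite [j == k]eq_sym kj andbF mulr0.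
rewrite (bigD1 i) //= big1 ?addr0 => [|l /negPf li]; last first.
  by rewrite [i == l]eq_sym li mulr0.
by rewrite !eqxx mulr1.
Qed.
End Ensemble.

(** * Even moments of sums of independent symmetric variables *)

Section EighthMoment.
Variables (R : realType) (d : nat).
Local Notation X := {ffun 'I_d -> alphabet}.

Definition opp_letter (a : alphabet) : alphabet :=
  let: (b0, b1, b2, b3) := a in (b0, ~~ b1, ~~ b2, b3).

Lemma opp_letterK : involutive opp_letter.
Proof. by case=> [[[b0 b1] b2] b3]; rewrite /opp_letter !negbK. Qed.

Lemma amp_opp (a : alphabet) : amp R (opp_letter a) = - amp R a.
Proof.
case: a => [[[b0 b1] b2] b3]; rewrite /amp /=; case: b0; last by rewrite oppr0.
by apply/eqP; rewrite eq_complex /= !signrN !eqxx.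
Qed.

Lemma sum_flip (V : nmodType) (j : 'I_d) (F : X -> V) :
  \sum_x F x = \sum_x F (upd x j (opp_letter (x j))).
Proof.
apply: (reindex_inj (inv_inj _)) => x.
by rewrite upd_same opp_letterK; apply/ffunP => i; rewrite !ffunE; case: eqP => // ->.
Qed.

Variables (f : 'I_d -> alphabet -> R) (c : 'I_d -> R).
Hypothesis f_odd : forall i a, f i (opp_letter a) = - f i a.
Hypothesis f_le : forall i a, f i a ^+ 2 <= c i.

Definition psum (r : seq 'I_d) (x : X) : R := \sum_(i <- r) f i (x i).

(** Induction on the coordinates with the Gaussian constants 1, 3, 15, 105. Flipping the sign of
    letter [j] cancels the odd powers of [f j], and the remaining binomial terms fit into the
    expansion of the powers of [s' + c j]. *)
Lemma sum_even_pow_le (r : seq 'I_d) : uniq r ->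
  let n := #|{: X}|%:R : R in let s := \sum_(i <- r) c i in
  [/\ \sum_x psum r x ^+ 2 <= n * s, \sum_x psum r x ^+ 4 <= n * (3 * s ^+ 2),
      \sum_x psum r x ^+ 6 <= n * (15 * s ^+ 3) & \sum_x psum r x ^+ 8 <= n * (105 * s ^+ 4)].
Proof.
move=> + n; elim: r => [_|j r IH /= /andP[jr ur]] /=.
  by rewrite !big_nil; split; rewrite big1 ?mulr_ge0 ?expr0n ?ler0n //= => x _;
    rewrite /psum big_nil expr0n.
have [h2 h4 h6 h8] := IH ur; rewrite big_cons.
set S' := psum r in h2 h4 h6 h8; set s' := (\sum_(i <- r) c i) in h2 h4 h6 h8 *.
have S'E (x : X) : psum (j :: r) x = f j (x j) + S' x by rewrite /psum big_cons.
have c0 : 0 <= c j by apply: le_trans (f_le j (true,true,true,true)); apply: sqr_ge0.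
have s0 : 0 <= s' by apply: sumr_ge0 => i _; apply: le_trans (f_le i (true,true,true,true)); apply: sqr_ge0.
have n0 : 0 <= n by exact: ler0n.
have S'flip (x : X) : S' (upd x j (opp_letter (x j))) = S' x.
  apply: eq_big_seq => i ir; rewrite ffunE; case: eqP => // ij.
  by rewrite -ij ir in jr.
have sym (p : nat) : \sum_(x : X) psum (j :: r) x ^+ p =
   \sum_(x : X) (2^-1 * ((f j (x j) + S' x) ^+ p + (- f j (x j) + S' x) ^+ p)).
  under eq_bigr do rewrite S'E.
  rewrite -mulr_sumr big_split /= [X in _ * (_ + X)](_ : _ = \sum_(x : X) (f j (x j) + S' x) ^+ p).
    by field.
  rewrite [RHS](sum_flip j); apply: eq_bigr => x _.
  by rewrite S'flip upd_same f_odd.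
have w2 (x : X) : 0 <= f j (x j) ^+ 2 <= c j by rewrite sqr_ge0 f_le.
have c2 : 0 <= c j ^+ 2 by rewrite exprn_ge0.
have c3 : 0 <= c j ^+ 3 by rewrite exprn_ge0.
have c4 : 0 <= c j ^+ 4 by rewrite exprn_ge0.
have wk k (x : X) : f j (x j) ^+ (2 * k) <= c j ^+ k.
  by rewrite exprM lerXn2r ?nnegrE ?sqr_ge0 ?f_le.
have Se k (x : X) : 0 <= S' x ^+ (2 * k) by rewrite exprM exprn_ge0 ?sqr_ge0.
have bnd k l (x : X) : f j (x j) ^+ (2 * k) * S' x ^+ (2 * l) <= c j ^+ k * S' x ^+ (2 * l).
  by rewrite ler_wpM2r.
have sumc (t : R) : \sum_(x : X) t = n * t by rewrite sumr_const mulr_natl.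
have nn a b : 0 <= n * (c j ^+ a * s' ^+ b) by rewrite !mulr_ge0 ?exprn_ge0.
have sp k : 0 <= s' ^+ k by rewrite exprn_ge0.
split; rewrite sym.
- apply: (@le_trans _ _ (\sum_x (S' x ^+ 2 + c j))).
    apply: ler_sum => x _; have := wk 1%N x; rewrite muln1 expr1; lra.
  by rewrite big_split /= sumc; lra.
- apply: (@le_trans _ _ (\sum_x (S' x ^+ 4 + 6 * c j * S' x ^+ 2 + c j ^+ 2))).
    apply: ler_sum => x _; have := wk 2%N x; have := bnd 1%N 1%N x.
    by rewrite !muln1 !expr1; lra.
  rewrite !big_split /= sumc -mulr_sumr.
  have := ler_wpM2l c0 h2; have := nn 2%N 0%N; lra.
- apply: (@le_trans _ _ (\sum_x (S' x ^+ 6 + 15 * c j * S' x ^+ 4 + 15 * c j ^+ 2 * S' x ^+ 2 + c j ^+ 3))).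
    apply: ler_sum => x _; have := wk 3%N x; have := bnd 1%N 2%N x; have := bnd 2%N 1%N x.
    by rewrite !muln1 !expr1; lra.
  rewrite !big_split /= sumc -!mulr_sumr.
  have := ler_wpM2l c0 h4; have := ler_wpM2l c2 h2.
  have := nn 2%N 1%N; have := nn 3%N 0%N; have := nn 1%N 2%N; lra.
- apply: (@le_trans _ _ (\sum_x (S' x ^+ 8 + 28 * c j * S' x ^+ 6 + 70 * c j ^+ 2 * S' x ^+ 4 + 28 * c j ^+ 3 * S' x ^+ 2 + c j ^+ 4))).
    apply: ler_sum => x _; have := wk 4%N x; have := bnd 1%N 3%N x; have := bnd 2%N 2%N x; have := bnd 3%N 1%N x.
    by rewrite !muln1 !expr1; lra.
  rewrite !big_split /= sumc -!mulr_sumr.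
  have := ler_wpM2l c0 h6; have := ler_wpM2l c2 h4; have := ler_wpM2l c3 h2.
  have := nn 2%N 2%N; have := nn 3%N 1%N; have := nn 1%N 3%N; have := nn 4%N 0%N; lra.
Qed.

End EighthMoment.

(** * Frobenius geometry of density matrices *)

Section States.
Variables (R : realType) (d : nat).
Local Notation C := R[i].
Implicit Types (rho W : 'M[C]_d) (psi : 'cV[C]_d).

Definition normsq (z : C) : R := complex.Re z ^+ 2 + complex.Im z ^+ 2.

Lemma normsq_ge0 z : 0 <= normsq z. Proof. by rewrite addr_ge0 ?sqr_ge0. Qed.

Lemma mul_conjc z : z * conjc z = ((normsq z)%:C)%C.
Proof. by case: z => a b; rewrite /normsq; simpc; rewrite /= !expr2 mulrC [b * a]mulrC addNr. Qed.

Definition frob W : R := \sum_i \sum_j normsq (W i j).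

Lemma frob_ge0 W : 0 <= frob W.
Proof. by apply: sumr_ge0 => i _; apply: sumr_ge0 => j _; apply: normsq_ge0. Qed.

Lemma frobN W : frob (- W) = frob W.
Proof.
apply: eq_bigr => i _; apply: eq_bigr => j _; rewrite mxE /normsq.
by case: (W i j) => a b /=; rewrite !sqrrN.
Qed.

Lemma cReD (x y : C) : complex.Re (x + y) = complex.Re x + complex.Re y.
Proof. by case: x y => a b [? ?]. Qed.

Lemma cRe_sum (I : finType) (F : I -> C) :
  complex.Re (\sum_i F i) = \sum_i complex.Re (F i).
Proof. exact: (big_morph _ cReD). Qed.

Lemma cReZ (r : R) (x : C) : complex.Re ((r%:C)%C * x) = r * complex.Re x.
Proof. by case: x => a b; simpc. Qed.

Lemma expvalE W psi :
  expval W psi = complex.Re (\sum_i \sum_j conjc (psi i 0) * W i j * psi j 0).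
Proof.
rewrite /expval mxE exchange_big /=; congr complex.Re; apply: eq_bigr => j _.
by rewrite mxE mulr_suml; apply: eq_bigr => i _; rewrite !mxE.
Qed.

Lemma unit_vector_normsq psi : unit_vector psi -> \sum_i normsq (psi i 0) = 1.
Proof.
move=> h; apply: complexI; rewrite rmorph_sum /= rmorph1 -h mxE; apply: eq_bigr => i _.
by rewrite !mxE mulrC mul_conjc.
Qed.

(** Expansion of the square: the projector on a unit vector has squared norm 1, and the cross term
    is the prediction error at [psi]. *)
Lemma frob_add_proj W rho psi (t : R) : unit_vector psi ->
  frob (W + (t%:C)%C *: (psi *m mxadj psi) - rho) =
  frob (W - rho) + 2 * t * (expval W psi - expval rho psi) + t ^+ 2.
Proof.
move=> h; have -> : expval W psi - expval rho psi = expval (W - rho) psi.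
  rewrite /expval mulmxBr mulmxBl.
  move: (mxadj psi *m W *m psi) (mxadj psi *m rho *m psi) => U V.
  by rewrite !mxE; case: (U 0 0) (V 0 0) => ? ? [].
have -> : W + (t%:C)%C *: (psi *m mxadj psi) - rho =
          (W - rho) + (t%:C)%C *: (psi *m mxadj psi) by rewrite addrAC.
move: (W - rho) => D.
have nD (x y : C) : normsq (x + (t%:C)%C * y) =
    normsq x + 2 * t * complex.Re (x * conjc y) + t ^+ 2 * normsq y.
  by case: x y => a b [a' b']; rewrite /normsq; simpc => /=; ring.
have entry i j : (psi *m mxadj psi) i j = psi i 0 * conjc (psi j 0).
  by rewrite mxE big_ord1 !mxE.
transitivity (\sum_i \sum_j (normsq (D i j) +
   2 * t * complex.Re (D i j * (conjc (psi i 0) * psi j 0)) +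
   t ^+ 2 * (normsq (psi i 0) * normsq (psi j 0)))).
  apply: eq_bigr => i _; apply: eq_bigr => j _.
  rewrite mxE [X in _ + X]mxE entry nD rmorphM /= conjcK; congr (_ + _ * _).
  by case: (psi i 0) (psi j 0) => a b [a' b']; rewrite /normsq; simpc => /=; ring.
transitivity (\sum_i (\sum_j normsq (D i j) +
   2 * t * \sum_j complex.Re (conjc (psi i 0) * D i j * psi j 0) +
   t ^+ 2 * normsq (psi i 0))).
  apply: eq_bigr => i _; rewrite !big_split /= -!mulr_sumr unit_vector_normsq // mulr1.
  congr (_ + _ * _ + _); apply: eq_bigr => j _; congr complex.Re; ring.
rewrite !big_split /= -!mulr_sumr unit_vector_normsq // mulr1 expvalE cRe_sum.
by congr (_ + _ * _ + _); apply: eq_bigr => i _; rewrite cRe_sum.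
Qed.

Lemma mxadj_delta k : mxadj (delta_mx k 0 : 'cV[C]_d) = delta_mx 0 k.
Proof. by apply/matrixP => a b; rewrite !mxE rmorph_nat andbC. Qed.

Lemma delta_form W i j :
  ((delta_mx 0 i : 'rV[C]_d) *m W *m (delta_mx j 0 : 'cV[C]_d)) 0 0 = W i j.
Proof. by rewrite -rowE -colE !mxE. Qed.

Variable rho : 'M[C]_d.
Hypothesis rho_density : density_matrix rho.

Lemma density_herm i j : rho j i = conjc (rho i j).
Proof. by have [h _ _] := rho_density; rewrite -[in LHS]h !mxE. Qed.

Lemma density_diag_ge0 i : 0 <= rho i i.
Proof.
have [_ pos _] := rho_density; have := pos (delta_mx i 0).
by rewrite mxadj_delta delta_form.
Qed.

Lemma density_minor i j :
  normsq (rho i j) <= complex.Re (rho i i) * complex.Re (rho j j).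
Proof.
have [_ pos _] := rho_density.
have quad (x y : C) : 0 <= complex.Re (conjc x * rho i i * x + conjc x * rho i j * y
                         + conjc y * rho j i * x + conjc y * rho j j * y).
  have := pos (x *: delta_mx i 0 + y *: delta_mx j 0).
  rewrite lecE => /andP[_] /le_trans; apply; rewrite le_eqVlt; apply/orP; left; apply/eqP.
  congr complex.Re.
  have -> : mxadj (x *: delta_mx i 0 + y *: delta_mx j 0) =
            conjc x *: delta_mx 0 i + conjc y *: (delta_mx 0 j : 'rV[C]_d).
    by rewrite -!mxadj_delta; apply/matrixP => a b; rewrite !mxE rmorphD !rmorphM.
  rewrite !mulmxDl !mulmxDr -!scalemxAl -!scalemxAr.
  have ent (x' y' : C) (M1 M2 M3 M4 : 'M[C]_1) :
      (x' *: (x *: M1) + x' *: (y *: M2) + (y' *: (x *: M3) + y' *: (y *: M4))) 0 0 =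
      x' * (x * M1 0 0) + x' * (y * M2 0 0) + (y' * (x * M3 0 0) + y' * (y * M4 0 0)).
    by rewrite !mxE.
  apply: etrans (ent _ _ _ _ _ _) _.
  rewrite (delta_form rho i i) (delta_form rho i j) (delta_form rho j i) (delta_form rho j j).
  move: (conjc x) (conjc y) (rho i i) (rho i j) (rho j i) (rho j j) => x' y' a b c e.
  ring.
have ri := density_diag_ge0 i; have rj := density_diag_ge0 j.
move: ri rj (quad); rewrite !lecE [rho j i]density_herm.
case: (rho i i) => a a'; case: (rho j j) => b b'; case: (rho i j) => u v /=.
move=> /andP[/eqP a'0 a0] /andP[/eqP b'0 b0]; rewrite a'0 b'0 => {a' b' a'0 b'0} q.
rewrite /normsq /=.
(* With [z = rho i j] and diagonal entries [a], [b]: if [a > 0], the vector [(-z, a)] gives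
   [a (a b - |z|^2) >= 0], and similarly for [b]; if both vanish, [(-z, 1)] gives
   [- 2 |z|^2 >= 0]. *)
have [aE|an] := eqVneq a 0; last first.
  have ap : 0 < a by rewrite lt_def an.
  have := q (- u +i* - v)%C (a +i* 0)%C; simpc => /= h.
  rewrite -(ler_pM2l ap); rewrite -subr_ge0; apply: le_trans h _; rewrite le_eqVlt; apply/orP; left; apply/eqP; ring.
have [bE|bn] := eqVneq b 0; last first.
  have bp : 0 < b by rewrite lt_def bn.
  have := q (b +i* 0)%C (- u +i* v)%C; simpc => /= h.
  rewrite -(ler_pM2l bp); rewrite -subr_ge0; apply: le_trans h _; rewrite le_eqVlt; apply/orP; left; apply/eqP; ring.
have := q (- u +i* - v)%C (1 +i* 0)%C; rewrite aE bE; simpc => /= h; lra.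
Qed.

(** The minor bounds sum to the square of the trace. *)
Lemma density_frob_le1 : frob rho <= 1.
Proof.
have [_ _ tr1] := rho_density.
apply: (@le_trans _ _ (\sum_i \sum_j complex.Re (rho i i) * complex.Re (rho j j))).
  by apply: ler_sum => i _; apply: ler_sum => j _; apply: density_minor.
rewrite -big_distrlr /= -cRe_sum; move: tr1; rewrite /mxtrace => ->.
by rewrite /= mulr1.
Qed.

(** The upper bound comes from the distance of [rho] to the projector: [0 <= frob rho - 2 expval + 1
    <= 2 - 2 expval]. *)
Lemma density_expval psi : unit_vector psi -> 0 <= expval rho psi <= 1.
Proof.
move=> h; have [_ pos _] := rho_density; apply/andP; split.
  by have := pos psi; rewrite lecE => /andP[].
have := frob_add_proj 0 rho 1 h; rewrite sub0r frobN.
have -> : expval 0 psi = 0 by rewrite /expval mulmx0 mul0mx mxE.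
have := frob_ge0 (0 + (1%:C)%C *: (psi *m mxadj psi) - rho).
have := density_frob_le1; lra.
Qed.
End States.

(** * The single-copy estimator and its moments *)

Section Shadows.
Variables (R : realType) (d : nat).
Local Notation C := R[i].
Local Notation X := {ffun 'I_d -> alphabet}.
Implicit Types (rho W : 'M[C]_d) (psi : 'cV[C]_d).

(** The factor [4^-d] is the square root of the uniform weight [16^-d] of a word, so that the
    rank-one operators sum to the identity. *)
Definition gvec (x : X) : 'cV[C]_d := \col_i ((4^-1 ^+ d)%:C%C * amp R (x i)).

Definition overlap psi (x : X) : R := complex.Re (qform (psi *m mxadj psi) x).

Let n16 : R := 16%:R ^+ d.

Let n16_gt0 : 0 < n16. Proof. by rewrite exprn_gt0. Qed.

Let quarter : 4^-1 ^+ d * 4^-1 ^+ d = n16^-1 :> R.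
Proof. by rewrite -exprMn -exprVn -invfM -natrM. Qed.

Let conjM (x y : C) : conjc (x * y) = conjc x * conjc y.
Proof. exact: rmorphM. Qed.

Let natC (k : nat) : k%:R = (k%:R : R)%:C%C :> C. Proof. by rewrite rmorph_nat. Qed.

Lemma gvec_povm a b : \sum_x gvec x a 0 * conjc (gvec x b 0) = (a == b)%:R.
Proof.
transitivity (((n16^-1)%:C%C) * \sum_(x : X) amp R (x a) * conjc (amp R (x b))).
  rewrite mulr_sumr; apply: eq_bigr => x _.
  by rewrite !mxE conjM conjc_real -quarter rmorphM /=; ring.
rewrite sum_amp2 natC natrM natrX -/n16 rmorphM mulrA -rmorphM mulVf ?(gt_eqF n16_gt0) //.
by rewrite rmorph1 mul1r rmorph_nat.
Qed.

Lemma born_gvec rho x : born gvec rho x = n16^-1 * complex.Re (qform rho x).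
Proof.
rewrite /born -cReZ; congr complex.Re.
rewrite mxE /qform exchange_big mulr_sumr /=; apply: eq_bigr => j _.
rewrite mxE mulr_suml mulr_sumr; apply: eq_bigr => i _.
by rewrite !mxE conjM conjc_real -quarter rmorphM /=; ring.
Qed.

Lemma qform_proj psi (x : X) :
  qform (psi *m mxadj psi) x = (normsq (\sum_i conjc (amp R (x i)) * psi i 0))%:C%C.
Proof.
rewrite -mul_conjc rmorph_sum big_distrlr; apply: eq_bigr => i _; apply: eq_bigr => j _.
by rewrite mxE big_ord1 !mxE rmorphM /= conjcK; ring.
Qed.

Lemma overlapE psi x : overlap psi x = normsq (\sum_i conjc (amp R (x i)) * psi i 0).
Proof. by rewrite /overlap qform_proj. Qed.

Lemma normsqM (z w : C) : normsq (z * w) = normsq z * normsq w.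
Proof. by case: z w => a b [a' b']; rewrite /normsq; simpc => /=; ring. Qed.

Lemma normsq_amp_le a : normsq (amp R a) <= 2.
Proof.
case: a => [[[b0 b1] b2] b3]; rewrite /amp /normsq; case: b0 => /=.
  by rewrite !sqrr_sign; lra.
by rewrite expr0n /=; lra.
Qed.

(** The eighth-moment bound applies to the real and the imaginary part of the inner product, with
    [c i = 2 |psi_i|^2] summing to 2; the factor 8 comes from [(a + b)^4 <= 8 (a^4 + b^4)]. *)
Lemma sum_overlap4_le psi : unit_vector psi ->
  \sum_(x : X) overlap psi x ^+ 4 <= n16 * (8 * (2 * (105 * 2 ^+ 4))).
Proof.
move=> /unit_vector_normsq u.
have c16 : #|alphabet| = 16%N by rewrite !card_prod card_bool.
have cardX : #|{: X}|%:R = n16 by rewrite card_ffun c16 card_ord natrX.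
pose fr (i : 'I_d) a := complex.Re (conjc (amp R a) * psi i 0).
pose fi (i : 'I_d) a := complex.Im (conjc (amp R a) * psi i 0).
have oppE i a : conjc (amp R (opp_letter a)) * psi i 0 = - (conjc (amp R a) * psi i 0).
  by rewrite amp_opp rmorphN mulNr.
have fro i a : fr i (opp_letter a) = - fr i a by rewrite /fr oppE; case: (_ * _).
have fio i a : fi i (opp_letter a) = - fi i a by rewrite /fi oppE; case: (_ * _).
have le2 i a : normsq (conjc (amp R a) * psi i 0) <= 2 * normsq (psi i 0).
  rewrite normsqM ler_wpM2r ?normsq_ge0 // -[X in X <= _](_ : normsq (amp R a) = _) ?normsq_amp_le //.
  by case: (amp R a) => ? ?; rewrite /normsq /= sqrrN.
have frl i a : fr i a ^+ 2 <= 2 * normsq (psi i 0).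
  by apply: le_trans (le2 i a); rewrite lerDl sqr_ge0.
have fil i a : fi i a ^+ 2 <= 2 * normsq (psi i 0).
  by apply: le_trans (le2 i a); rewrite lerDr sqr_ge0.
have [_ _ _] := sum_even_pow_le fro frl (index_enum_uniq 'I_d).
have [_ _ _] := sum_even_pow_le fio fil (index_enum_uniq 'I_d).
rewrite /= cardX -mulr_sumr u mulr1 => hi hr.
apply: (@le_trans _ _ (\sum_(x : X) (8 * (psum fr (index_enum 'I_d) x ^+ 8 + psum fi (index_enum 'I_d) x ^+ 8)))).
  apply: ler_sum => x _; rewrite overlapE /normsq /psum cRe_sum -/(fr _ _).
  have -> : complex.Im (\sum_i conjc (amp R (x i)) * psi i 0) = \sum_i fi i (x i).
    apply: (big_morph (@complex.Im R)) => //; by case=> ? ? [].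
  set p := \sum_i _; set q := \sum_i fi _ _.
  have -> : p ^+ 8 = (p ^+ 2) ^+ 4 by rewrite -exprM.
  have -> : q ^+ 8 = (q ^+ 2) ^+ 4 by rewrite -exprM.
  move: (p ^+ 2) (q ^+ 2) (sqr_ge0 p) (sqr_ge0 q) => a b a0 b0.
  have h1 : (a + b) ^+ 2 <= 2 * (a ^+ 2 + b ^+ 2) by have := sqr_ge0 (a - b); nra.
  have h2 : (a ^+ 2 + b ^+ 2) ^+ 2 <= 2 * (a ^+ 4 + b ^+ 4).
    by have := sqr_ge0 (a ^+ 2 - b ^+ 2); lra.
  have : ((a + b) ^+ 2) ^+ 2 <= (2 * (a ^+ 2 + b ^+ 2)) ^+ 2.
    by rewrite lerXn2r ?nnegrE ?sqr_ge0 // mulr_ge0 // addr_ge0 ?sqr_ge0.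
  by rewrite -exprM exprMn; lra.
rewrite -mulr_sumr big_split /=; lra.
Qed.

Variable rho : 'M[C]_d.
Hypothesis rho_density : density_matrix rho.

Let qform_real x : qform rho x = (complex.Re (qform rho x))%:C%C.
Proof.
have [_ pos _] := rho_density.
rewrite RRe_real // ger0_real //.
have [v vE] : exists v : 'cV[C]_d, forall i, v i 0 = amp R (x i).
  by exists (\col_i amp R (x i)) => i; rewrite mxE.
suff -> : qform rho x = (mxadj v *m rho *m v) 0 0 by exact: pos.
rewrite mxE /qform exchange_big /=; apply: eq_bigr => j _.
by rewrite mxE mulr_suml; apply: eq_bigr => i _; rewrite !mxE !vE.
Qed.

Lemma born_ge0 x : 0 <= born gvec rho x.
Proof.
have [_ pos _] := rho_density.
by have := pos (gvec x); rewrite lecE => /andP[].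
Qed.

Let sum_Re_qform2 W : (forall x, qform W x = (complex.Re (qform W x))%:C%C) ->
  \sum_(x : X) complex.Re (qform rho x) * complex.Re (qform W x) =
  n16 * complex.Re (\tr W + \tr (rho *m W)).
Proof.
move=> hW; have [_ _ tr1] := rho_density.
transitivity (complex.Re (\sum_(x : X) qform rho x * qform W x)).
  by rewrite cRe_sum; apply: eq_bigr => x _; rewrite qform_real hW cReZ.
by rewrite sum_qform2 natC cReZ tr1 mul1r natrX.
Qed.

Lemma born_sum1 : \sum_x born gvec rho x = 1.
Proof.
have [_ _ tr1] := rho_density.
transitivity (complex.Re (\sum_(x : X) \sum_i \sum_j rho i j * (gvec x j 0 * conjc (gvec x i 0)))).
  rewrite cRe_sum; apply: eq_bigr => x _; rewrite /born; congr complex.Re.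
  rewrite mxE exchange_big /=; apply: eq_bigr => j _.
  by rewrite mxE mulr_suml; apply: eq_bigr => i _; rewrite !mxE; ring.
rewrite exchange_big /= -[RHS]/(complex.Re (1 : C)) -tr1; congr complex.Re.
apply: eq_bigr => i _; rewrite exchange_big /= (bigD1 i) //= [X in _ + X]big1 => [|j ji].
  by rewrite -mulr_sumr gvec_povm eqxx mulr1 addr0.
by rewrite -mulr_sumr gvec_povm (negPf ji) mulr0.
Qed.

Lemma trace_proj W psi : \tr (W *m (psi *m mxadj psi)) = (mxadj psi *m W *m psi) 0 0.
Proof. by rewrite mulmxA mxtrace_mulC mulmxA trace_mx11. Qed.

(** By [sum_qform2] the Born mean of [overlap] is [1 + expval rho psi]; the shift by 1 removes the
    trace term. *)
Lemma born_mean psi : unit_vector psi ->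
  \sum_x born gvec rho x * (overlap psi x - 1) = expval rho psi.
Proof.
move=> u; have hW x : qform (psi *m mxadj psi) x = (complex.Re (qform (psi *m mxadj psi) x))%:C%C.
  by rewrite qform_proj.
under eq_bigr do rewrite mulrBr mulr1.
rewrite sumrB born_sum1; under eq_bigr do rewrite born_gvec -mulrA.
rewrite -mulr_sumr (sum_Re_qform2 hW) mulKf ?(gt_eqF n16_gt0) // trace_proj cReD.
by rewrite mxtrace_mulC trace_mx11 u /= addrAC subrr add0r.
Qed.

(** The Born law is the uniform one weighted by [qform rho]. By [x y <= (x^2 + y^2) / 2], only the
    uniform means of [(qform rho)^2], at most 2, and of [overlap^4], at most 26880, are needed; half
    their sum is below [4^7]. *)
Lemma born_second_moment psi : unit_vector psi ->
  \sum_x born gvec rho x * overlap psi x ^+ 2 <= 4 ^+ 7.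
Proof.
move=> u.
apply: (@le_trans _ _ (\sum_x n16^-1 * (2^-1 * (complex.Re (qform rho x) * complex.Re (qform rho x) + overlap psi x ^+ 4)))).
  apply: ler_sum => x _; rewrite born_gvec -mulrA ler_wpM2l ?invr_ge0 ?(ltW n16_gt0) //.
  by have := sqr_ge0 (complex.Re (qform rho x) - overlap psi x ^+ 2); lra.
rewrite -!mulr_sumr big_split /= (sum_Re_qform2 qform_real).
have [_ _ tr1] := rho_density.
have h4 := sum_overlap4_le u.
have h2 : complex.Re (\tr rho + \tr (rho *m rho)) <= 2.
  rewrite tr1 cReD /=; suff : complex.Re (\tr (rho *m rho)) <= 1 by lra.
  apply: le_trans (density_frob_le1 rho_density); rewrite le_eqVlt; apply/orP; left; apply/eqP.
  rewrite /mxtrace cRe_sum; apply: eq_bigr => i _; rewrite mxE cRe_sum; apply: eq_bigr => j _.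
  by rewrite (density_herm rho_density i j) mul_conjc.
rewrite ler_pdivrMl ?n16_gt0 //; have := ler_wpM2l (ltW n16_gt0) h2; have := n16_gt0; lra.
Qed.

End Shadows.

(** * The learner: corrections, their budget and their correctness *)

Section Learner.
Variables (R : realType) (d m T : nat) (eps : R).
Local Notation C := R[i].
Local Notation X := {ffun 'I_d -> alphabet}.
Local Notation Y := {ffun 'I_m -> X}.
Local Notation eta := (eps / 4).

Definition group_mean (psi : 'cV[C]_d) (y : Y) : R :=
  (\sum_k overlap psi (y k)) / m%:R - 1.

Definition level (w : R) (s : bool) (k : nat) : R := w + (-1) ^+ s * (k%:R * eta).

(** The sign [s] is [true] for downward corrections. The threshold [eps / 2 = 2 eta] leaves a margin
    [eta] on either side for the error of a group mean. *)
Definition test (psi : 'cV[C]_d) (s : bool) (w : R) (y : Y) : bool :=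
  eps / 2 <= (-1) ^+ s * (group_mean psi y - w).

Fixpoint climb (psi : 'cV[C]_d) (w : R) (s : bool) (B k : nat) : prog Y (bool * nat) :=
  match B with
  | 0 => Ret _ (s, k)
  | B'.+1 => Test (test psi s (level w s k))
               (fun b => if b then climb psi w s B' k.+1 else Ret _ (s, k))
  end.

(** The downward climb starts only if the upward one made no correction, so a query receives at most
    two false answers. *)
Definition query (psi : 'cV[C]_d) (w : R) (B : nat) : prog Y (bool * nat) :=
  bindp (climb psi w false B 0)
    (fun o => if o.2 == 0%N then climb psi w true B 0 else Ret _ o).

Definition next_state (st : 'M[C]_d * nat) (qa : 'cV[C]_d * R) : 'M[C]_d * nat :=
  let: (W, B) := st in let: (psi, e) := qa in
  (W + ((e - expval W psi)%:C)%C *: (psi *m mxadj psi),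
   (B - Num.truncn (`|e - expval W psi| / eta)%R)%N).

(* The hypothesis matrix and the remaining number of corrections are recovered
   from the answers alone, since these determine the corrections made. *)
Definition state (h : history R d) : 'M[C]_d * nat := foldl next_state (0, T) h.

Definition outcomes : nat := #|{: bool * 'I_T.+1}|.

Definition code (a : bool * nat) : 'I_outcomes := enum_rank (a.1, inord a.2).

Definition answer (h : history R d) (psi : 'cV[C]_d) (o : 'I_outcomes) : R :=
  let: (s, k) := enum_val o in level (expval (state h).1 psi) s k.

Definition ask (h : history R d) (psi : 'cV[C]_d) : prog Y (bool * nat) :=
  query psi (expval (state h).1 psi) (state h).2.

Lemma state_rcons h psi a : 0 < eps -> (a.2 <= T)%N ->
  let: (W, B) := state h in
  state (rcons h (psi, answer h psi (code a))) =
  (W + (((-1) ^+ a.1 * (a.2%:R * eta))%:C)%C *: (psi *m mxadj psi), (B - a.2)%N).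
Proof.
move=> e0 aT; rewrite /state -cats1 foldl_cat /= -/(state h) /answer.
case: (state h) => W B; rewrite /code enum_rankK /= /level inordK // [X in X - _]addrC addrK.
congr (_, (_ - _)%N).
have eta0 : 0 < eta by rewrite divr_gt0.
have k0 : 0 <= a.2%:R * eta by rewrite mulr_ge0 // ltW.
by rewrite normrM normr_sign mul1r (ger0_norm k0) mulfK ?gt_eqF // natrK.
Qed.

(** [c] answers are reserved for later, beyond one for each correction left; the strict inequality
    pays for the false answer that may end the climb. *)
Lemma climb_bud psi w (s : bool) B D k c : (B + c < D)%N ->
  bud (fun B' D' o => (B' + c <= D')%N /\ (o.2 + B' = k + B)%N) B D (climb psi w s B k).
Proof.
elim: B D k => [|B IH] [|D] k //=; first by move=> /ltnW.
rewrite addSn ltnS => h; split; last by split; rewrite ?addSn.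
by have := IH D k.+1 h; rewrite addSnnS.
Qed.

Lemma query_bud psi w B D c : (B + c.+1 < D)%N ->
  bud (fun B' D' o => (B' + c <= D')%N /\ (o.2 + B' = B)%N) B D (query psi w B).
Proof.
move=> h; apply: bud_bind (climb_bud _ _ _ _ h) => B' D' o [h1 h2].
case: eqP => [o0|_] /=; last by split; lia.
have eB : B' = B by lia.
rewrite eB; apply: (@climb_bud psi w true B D' 0 c); lia.
Qed.

Variables (rho : 'M[C]_d) (A : history R d -> 'cV[C]_d).

(** Analyst and accuracy check are folded into one program, so that the bounds for arbitrary
    programs apply to the whole game. *)
Fixpoint interaction (n : nat) (h : history R d) : prog Y bool :=
  match n with
  | 0 => Ret _ true
  | n'.+1 => bindp (ask h (A h)) (fun a =>
      let e := answer h (A h) (code a) in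
      if `|e - expval rho (A h)| <= eps then interaction n' (rcons h (A h, e))
      else Ret _ false)
  end.

Lemma interaction_bud n h D : 0 < eps -> ((state h).2 <= T)%N ->
  ((state h).2 + 2 * n <= D)%N ->
  bud (fun _ _ _ => True) (state h).2 D (interaction n h).
Proof.
move=> e0; elim: n h D => [|n IH] h D hT hD //=.
apply: bud_bind (query_bud _ _ (c := (2 * n)%N) _); last by lia.
move=> B' D' a [h1 h2]; case: ifP => // _.
have aT : (a.2 <= T)%N by lia.
have := state_rcons h (A h) e0 aT; case eS: (state h) => [W B] /= st.
have eB : (state (rcons h (A h, answer h (A h) (code a)))).2 = B'.
  by rewrite st /=; move: h2; rewrite eS /=; lia.
rewrite -eB; apply: IH; rewrite eB //; move: hT h2; rewrite eS /=; lia.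
Qed.

(** The continuation depends on the outcome of [ask] only through its code, so the expectation
    splits over codes, as in [answers_ok]. *)
Lemma interaction_ev (G : nat) (sigma : R) (S : {ffun 'I_G -> Y}) n h :
  ev sigma S (interaction n.+1 h) (fun b => b%:R) =
  \sum_o (if `|answer h (A h) o - expval rho (A h)| <= eps then
     ev sigma S (ask h (A h)) (fun a => (code a == o)%:R) *
     ev sigma S (interaction n (rcons h (A h, answer h (A h) o))) (fun b => b%:R) else 0).
Proof.
rewrite /= ev_bind.
pose F o := if `|answer h (A h) o - expval rho (A h)| <= eps then
  ev sigma S (interaction n (rcons h (A h, answer h (A h) o))) (fun b => b%:R) else 0.
transitivity (ev sigma S (ask h (A h)) (fun a => \sum_o F o * (code a == o)%:R)).
  apply: eq_ev => a; rewrite (bigD1 (code a)) //= big1 => [|o /negPf oa].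
    by rewrite eqxx mulr1 addr0 /F; case: ifP.
  by rewrite eq_sym oa mulr0.
rewrite ev_sum; apply: eq_bigr => o _; rewrite evZ /F mulrC.
by case: ifP; rewrite ?mulr0.
Qed.

Hypothesis rho_density : density_matrix rho.
Hypothesis eps_gt0 : 0 < eps.
Hypothesis m_large : 100 * 4 ^+ 7 <= m%:R * eta ^+ 2.
Hypothesis T_large : 1 < T%:R * eta ^+ 2.

Local Notation P := (born (@gvec R d) rho).

Definition improbable (h : Y -> bool) (b : bool) : bool :=
  \sum_(y | h y == b) prodw P y <= 100^-1.

Let P_ge0 := born_ge0 rho_density.
Let P_sum1 := born_sum1 rho_density.

(** Chebyshev: the mean over [m] copies has variance at most [4^7 / m], which [m_large] bounds by
    [eta^2 / 100]. *)
Lemma group_mean_dev psi : unit_vector psi ->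
  \sum_(y | eta <= `|group_mean psi y - expval rho psi|) prodw P y <= 100^-1.
Proof.
move=> u; set v := expval rho psi.
have eta0 : 0 < eta by rewrite divr_gt0.
have m0 : 0 < m%:R :> R.
  rewrite lt_def ler0n andbT; apply/negP => /eqP m0; move: m_large; rewrite m0 mul0r; lra.
pose f (x : X) := overlap psi x - 1 - v.
have f0 : \sum_x P x * f x = 0.
  under eq_bigr do rewrite mulrBr.
  by rewrite sumrB born_mean // -mulr_suml P_sum1 mul1r subrr.
have f2 : \sum_x P x * f x ^+ 2 <= 4 ^+ 7.
  apply: le_trans (born_second_moment rho_density u).
  have /andP[v0 v1] := density_expval rho_density u.
  have -> : \sum_x P x * f x ^+ 2 =
            \sum_x (P x * overlap psi x ^+ 2 - 2 * (1 + v) * (P x * f x) - (1 + v) ^+ 2 * P x).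
    by apply: eq_bigr => x _; rewrite /f; ring.
  rewrite !sumrB -!mulr_sumr f0 P_sum1 mulr0 subr0 mulr1.
  by rewrite gerBl sqr_ge0.
have dev (y : Y) : group_mean psi y - v = m%:R^-1 * \sum_k f (y k).
  have -> : \sum_k f (y k) = \sum_k overlap psi (y k) - m%:R * (1 + v).
    rewrite mulr_natl -[in X in _ - X](card_ord m) -sumr_const -sumrB.
    by apply: eq_bigr => k _; rewrite /f opprD addrA.
  by rewrite /group_mean; field; rewrite gt_eqF.
have h2 : \sum_(y : Y) prodw P y * (group_mean psi y - v) ^+ 2 <= 4 ^+ 7 / m%:R.
  under eq_bigr do rewrite dev exprMn mulrCA.
  rewrite -mulr_sumr prodw_sum_sqr // card_ord.
  rewrite expr2 -mulrA mulKf ?gt_eqF // mulrC.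
  by rewrite ler_wpM2r ?invr_ge0 ?(ltW m0).
apply: le_trans (chebyshev _ eta0 h2) _; first by move=> y; apply: prodw_ge0.
rewrite -mulrA -invfM ler_pdivrMr ?mulr_gt0 ?exprn_gt0 //; have := m_large; lra.
Qed.

Lemma improbable_dev psi h b : unit_vector psi ->
  (forall y, h y = b -> eta <= `|group_mean psi y - expval rho psi|) -> improbable h b.
Proof.
move=> u hb; apply: le_trans (group_mean_dev u); rewrite big_mkcond [leRHS]big_mkcond /=.
apply: ler_sum => y _; case: eqP => [/hb -> //|_].
by case: ifP => // _; apply: prodw_ge0.
Qed.

Let normr_sgnM (s : bool) (x : R) : `|(-1) ^+ s * x| = `|x|.
Proof. by rewrite normrM normr_sign mul1r. Qed.

(** A true answer shows a measured gap of at least [2 eta]; if the real gap were at most [eta],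
    every group giving this answer would deviate by [eta]. *)
Lemma test_true psi (s : bool) w : unit_vector psi -> ~~ improbable (test psi s w) true ->
  eta < (-1) ^+ s * (expval rho psi - w).
Proof.
move=> u; rewrite ltNge; apply: contra => le; apply: improbable_dev u _ => y.
move=> ht; have {}ht : eps / 2 <= (-1) ^+ s * (group_mean psi y - w) := ht.
rewrite -(normr_sgnM s).
apply: le_trans (ler_norm _); case: s le ht; rewrite ?expr0 ?expr1; lra.
Qed.

Lemma test_false psi (s : bool) w : unit_vector psi -> ~~ improbable (test psi s w) false ->
  (-1) ^+ s * (expval rho psi - w) < 3 * eta.
Proof.
move=> u; rewrite ltNge; apply: contra => le; apply: improbable_dev u _ => y.
rewrite /test => /negbT; rewrite -ltNge => ht.
rewrite -(normr_sgnM s) -normrN.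
apply: le_trans (ler_norm _); case: s le ht; rewrite ?expr0 ?expr1; lra.
Qed.

Definition potential (W : 'M[C]_d) (psi : 'cV[C]_d) (s : bool) (k : nat) : R :=
  frob (W + (((-1) ^+ s * (k%:R * eta))%:C)%C *: (psi *m mxadj psi) - rho).

Lemma potential_ge0 W psi s k : 0 <= potential W psi s k.
Proof. exact: frob_ge0. Qed.

Lemma potential0 W psi s : potential W psi s 0 = frob (W - rho).
Proof. by rewrite /potential mul0r mulr0 scale0r addr0. Qed.

Lemma potentialE W psi s k : unit_vector psi ->
  potential W psi s k = frob (W - rho) + 2 * ((-1) ^+ s * (k%:R * eta)) *
    (expval W psi - expval rho psi) + ((-1) ^+ s * (k%:R * eta)) ^+ 2.
Proof. exact: frob_add_proj. Qed.

(* Unfolding these during unification is very costly. *)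
#[local] Opaque potential expval frob.

(** A step at a gap above [eta] changes the squared distance by [- 2 eta gap + eta^2 < - eta^2]. *)
Lemma potential_step W psi (s : bool) k : unit_vector psi ->
  eta < (-1) ^+ s * (expval rho psi - level (expval W psi) s k) ->
  potential W psi s k.+1 + eta ^+ 2 <= potential W psi s k.
Proof.
move=> u; rewrite !potentialE // /level -[k.+1%:R]natr1.
have eta0 : 0 < eta by rewrite divr_gt0.
move=> /ltW /(ler_wpM2l (ltW eta0)).
move: (frob _) (expval rho psi) (expval W psi) (k%:R : R) => F v w x.
by case: s => /=; rewrite ?expr0 ?expr1; lra.
Qed.

(** Two invariants: every correction spent has lowered the potential by [eta^2], and a step taken at
    a gap above [eta] does not overshoot. *)
Lemma climb_allok W psi (s : bool) B k : unit_vector psi ->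
  potential W psi s k + eta ^+ 2 * (T%:R - B%:R) <= 1 ->
  ((0 < k)%N -> 0 <= (-1) ^+ s * (expval rho psi - level (expval W psi) s k)) ->
  allok improbable (fun o : bool * nat =>
    [/\ o.1 = s, (-1) ^+ s * (expval rho psi - level (expval W psi) s o.2) < 3 * eta,
     (0 < o.2)%N -> 0 <= (-1) ^+ s * (expval rho psi - level (expval W psi) s o.2),
     potential W psi s o.2 + eta ^+ 2 * (T%:R - (B + k)%:R + o.2%:R) <= 1 & (o.2 <= B + k)%N])
   (climb psi (expval W psi) s B k).
Proof.
move=> u; have eta0 : 0 < eta by rewrite divr_gt0.
elim: B k => [|B IH] k hp hk /=.
  (* With no correction left, the invariant and a nonnegative potential give [T * eta^2 <= 1],
     against [T_large]. *)
  have p0 := potential_ge0 W psi s k.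
  by move: T_large hp; rewrite subr0; lra.
case=> hb /=; last first.
  split=> //; [exact: test_false hb | | by rewrite leq_addl].
  by rewrite natrD; lra.
have lt := test_true u hb; have st := potential_step u lt.
rewrite addSnnS; apply: IH.
  apply: le_trans hp; rewrite -[B.+1%:R]natr1.
  have -> : eta ^+ 2 * (T%:R - B%:R) = eta ^+ 2 + eta ^+ 2 * (T%:R - (B%:R + 1)) by ring.
  have gen (x x' e y : R) : x' + e <= x -> x' + (e + y) <= x + y by rewrite addrA lerD2r.
  exact: gen st.
move=> _; rewrite /level -[k.+1%:R]natr1; move: lt; rewrite /level.
by case: s {hp hk hb st} => /=; rewrite ?expr0 ?expr1; lra.
Qed.

Lemma query_allok W psi B : unit_vector psi ->
  frob (W - rho) + eta ^+ 2 * (T%:R - B%:R) <= 1 ->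
  allok improbable (fun o : bool * nat =>
    [/\ `|expval rho psi - level (expval W psi) o.1 o.2| < 3 * eta,
     potential W psi o.1 o.2 + eta ^+ 2 * (T%:R - (B - o.2)%:R) <= 1 & (o.2 <= B)%N])
   (query psi (expval W psi) B).
Proof.
move=> u hW; have eta0 : 0 < eta by rewrite divr_gt0.
have p0 := potential0 W psi.
have l0 s : level (expval W psi) s 0 = expval W psi by rewrite /level mul0r mulr0 addr0.
apply: allok_bind (climb_allok u (s := false) (B := B) (k := 0%N) _ _) => //; last first.
  by rewrite p0.
move=> -[s k] /= [-> h1 h2 h3 h4]; rewrite addn0 in h3 h4.
case: eqP => [k0|/eqP k0] /=; last first.
  have kp : (0 < k)%N by rewrite lt0n.
  split; [|by rewrite natrB // (_ : T%:R - (B%:R - k%:R) = T%:R - B%:R + k%:R) //; ring|exact: h4].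
  by have := h2 kp; move: h1; rewrite expr0 !mul1r => ? ?; rewrite ger0_norm.
rewrite k0 l0 expr0 mul1r in h1.
have hT : potential W psi true 0 + eta ^+ 2 * (T%:R - B%:R) <= 1 by rewrite p0.
have := climb_allok u hT (fun h : (0 < 0)%N => False_ind _ (Bool.diff_false_true h)).
apply: allok_sub => -[s' k'] /= [-> g1 g2 g3 g4]; rewrite addn0 in g3 g4.
split; [|by rewrite natrB // (_ : T%:R - (B%:R - k'%:R) = T%:R - B%:R + k'%:R) //; ring|exact: g4].
(* In the first case neither climb has moved, and their two one-sided bounds together control the
   absolute value. *)
have [k'0|k'p] := posnP k'.
  move: g1 h1; rewrite k'0 l0 expr1 mulN1r; move: (expval rho psi - _) => x h1 h2'.
  by rewrite ltr_norml h2' andbT ltrNl.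
have := g2 k'p; move: g1; rewrite expr1 !mulN1r => g1 g2'.
by rewrite -normrN ger0_norm.
Qed.

Lemma interaction_allok n h : (forall h, unit_vector (A h)) ->
  frob ((state h).1 - rho) + eta ^+ 2 * (T%:R - (state h).2%:R) <= 1 ->
  ((state h).2 <= T)%N -> allok improbable is_true (interaction n h).
Proof.
move=> uA; elim: n h => [|n IH] h hp hT //=.
apply: allok_bind (query_allok (uA h) hp) => -[s k] /= [h1 h2 h3].
have kT : (k <= T)%N by lia.
have := state_rcons h (A h) (a := (s, k)) eps_gt0 kT.
case eS : (state h) => [W B] /= st; rewrite eS /= in h1 h2 h3 hT.
have ansE : answer h (A h) (code (s, k)) = level (expval W (A h)) s k.
  by rewrite /answer /code enum_rankK eS /= inordK.
rewrite ifT; last first.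
  by rewrite ansE distrC; have := eps_gt0; lra.
by apply: IH; rewrite st //=; lia.
Qed.

End Learner.

(** * Success probability of the learner *)

Section Guarantee.
Variables (R : realType) (d G m T : nat) (eps sigma : R).
Local Notation C := R[i].
Local Notation X := {ffun 'I_d -> alphabet}.

Definition answer_law (s : {ffun 'I_(G * m) -> X}) (h : history R d) (psi : 'cV[C]_d)
    (o : 'I_(outcomes T)) : R :=
  ev sigma (blocks s) (ask m T eps h psi) (fun a => (code T a == o)%:R).

Definition learner : algorithm R d (G * m) _ (outcomes T) _ :=
  simulation (@gvec R d) answer_law (answer eps).

Lemma answer_law_ge0 s h psi o : 0 <= answer_law s h psi o.
Proof. by apply: ev_ge0 => a; rewrite ler0n. Qed.

Lemma learner_valid : valid_algorithm learner.
Proof.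
apply: simulation_valid; [exact: gvec_povm | exact: answer_law_ge0 | move=> s h psi].
rewrite -ev_sum -[RHS](ev_cst sigma (blocks s) (ask m T eps h psi)); apply: eq_ev => a.
by rewrite (bigD1 (code T a)) //= eqxx big1 ?addr0 // => o /negPf; rewrite eq_sym => ->.
Qed.

Lemma learner_success (rho : 'M[C]_d) (A : history R d -> 'cV[C]_d) (M : nat) (delta : R) :
  0 < eps -> 100 * 4 ^+ 7 <= m%:R * (eps / 4) ^+ 2 -> 1 < T%:R * (eps / 4) ^+ 2 ->
  density_matrix rho -> (forall h, unit_vector (A h)) ->
  fail_prob (improbable rho) G sigma (prodw (born (@gvec R d) rho))
    (interaction m T eps rho A M [::]) <= delta ->
  (((1 - delta)%:C)%C <= success_prob rho learner A eps M).
Proof.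
move=> e0 mL TL rhoD uA fail.
rewrite success_prob_simulation //; last exact: answer_law_ge0.
rewrite lecR.
have okE n h s : answers_ok answer_law (answer eps) rho A eps n h s =
    ev sigma (blocks s) (interaction m T eps rho A n h) (fun b => b%:R).
  elim: n h => [//|n IH] h; rewrite interaction_ev /=.
  by apply: eq_bigr => o _; case: ifP => // _; rewrite IH.
under eq_bigr do rewrite okE.
rewrite (prodw_blocks _ (fun S => ev sigma S (interaction m T eps rho A M [::]) (fun b => b%:R))).
have P1 := prodw_sum1 'I_m (born_sum1 rhoD).
apply: le_trans (lerB (lexx 1) fail) _.
pose w (S : {ffun 'I_G -> {ffun 'I_m -> X}}) := prodw (prodw (born (@gvec R d) rho)) S.
have w1 : \sum_S w S = 1 by exact: prodw_sum1.
have -> : 1 - fail_prob (improbable rho) G sigma (prodw (born (@gvec R d) rho))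
      (interaction m T eps rho A M [::]) =
    \sum_S w S * (1 - ev sigma S (guard (improbable rho) (interaction m T eps rho A M [::]))
                       (fun o => (failed (improbable rho) o)%:R)).
  by under [RHS]eq_bigr do rewrite mulrBr mulr1; rewrite sumrB w1.
apply: ler_sum => S _; rewrite ler_wpM2l //.
  by apply: prodw_ge0 => y; apply: prodw_ge0; exact: born_ge0.
apply: (@allok_ev R _ (improbable rho) G sigma _ S _ (fun b => b)).
apply: (interaction_allok rhoD e0 mL TL) => //=.
(* Initially [W = 0] and all [T] corrections are left, so the invariant reads [frob rho <= 1]. *)
by rewrite subrr mulr0 addr0 sub0r frobN density_frob_le1.
Qed.
End Guarantee.

(** * Choice of temperature and number of groups *)

Section SampleSize.
Variables (R : realType) (M : nat) (eps delta : R).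
Hypothesis M_ge2 : (2 <= M)%N.
Hypothesis eps_gt0 : 0 < eps.
Hypothesis eps_lt : eps < 2^-1.
Hypothesis delta_gt0 : 0 < delta.
Hypothesis delta_lt1 : delta < 1.

Let a : R := ln M%:R.
Let b : R := ln (1 / eps).
Let l : R := ln (1 / (eps * delta)).
Let r : R := Num.sqrt l.
Let i : R := eps^-1.
(** The target bound without a factor [1 / eps^2], which the group size contributes. *)
Let Q : R := a * b * r ^+ 3 * i.

Definition corrections : nat := (Num.truncn (16 / eps ^+ 2)).+1.
Local Notation T := corrections.
Local Notation D := (T + 2 * M)%N.

Let half_le_ln (x : R) : 2 <= x -> 2^-1 <= ln x.
Proof.
move=> x2; rewrite -[leLHS]expRK ler_ln ?posrE ?expR_gt0 //; last by lra.
by apply: le_trans x2; exact: expR_half_le2.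
Qed.

Let i_ge2 : 2 <= i.
Proof. by rewrite /i -[leLHS]invrK lef_pV2 ?posrE ?invr_gt0 // ltW. Qed.

Let a_ge : 2^-1 <= a. Proof. by apply: half_le_ln; rewrite ler_nat. Qed.

Let b_ge : 2^-1 <= b. Proof. by apply: half_le_ln; rewrite div1r. Qed.

Let l_eq : l = b + - ln delta.
Proof. by rewrite /l /b !div1r invfM lnM ?posrE ?invr_gt0 // [in X in _ + X]lnV. Qed.

Let b_le : b <= l.
Proof. by rewrite l_eq lerDl oppr_ge0 ltW // ln_lt0 // delta_gt0. Qed.

Let l_ge : 2^-1 <= l. Proof. exact: le_trans b_ge b_le. Qed.

Let r2 : r ^+ 2 = l.
Proof. by rewrite sqr_sqrtr //; apply: le_trans l_ge; rewrite invr_ge0. Qed.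

Let r_ge : 2^-1 <= r.
Proof. by have r0 : 0 <= r := sqrtr_ge0 _; have := r2; have := l_ge; nra. Qed.

Let expa : expR a = M%:R. Proof. by rewrite lnK // posrE ltr0n; lia. Qed.
Let expb : expR b = i. Proof. by rewrite lnK ?div1r // posrE invr_gt0. Qed.
Let expNl : expR (- l) = eps * delta.
Proof. by rewrite expRN lnK ?posrE ?divr_gt0 ?mulr_gt0 // div1r invrK. Qed.

Let ab_ge : 4^-1 <= a * b. Proof. by have := a_ge; have := b_ge; nra. Qed.

Let r3_ge : 8^-1 <= r ^+ 3.
Proof.
have r0 : 0 <= r by apply: le_trans r_ge; rewrite invr_ge0.
have -> : (8^-1 : R) = 2^-1 ^+ 3 by rewrite exprVn -natrX.
by rewrite lerXn2r ?nnegrE ?invr_ge0.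
Qed.

Let Q_ge : 16^-1 <= Q.
Proof.
have h : 32^-1 <= a * b * r ^+ 3.
  have -> : (32^-1 : R) = 4^-1 * 8^-1 by rewrite -invfM -natrM.
  by rewrite ler_pM ?invr_ge0.
have := ler_pM _ _ h i_ge2; rewrite /Q; lra.
Qed.

Let T_le : T%:R <= 17 * i ^+ 2.
Proof.
have h : (Num.truncn (16 / eps ^+ 2))%:R <= 16 / eps ^+ 2.
  by rewrite truncn_le divr_ge0 // exprn_ge0 // ltW.
have i1 : 1 <= i ^+ 2 by have := i_ge2; nra.
by rewrite /corrections -natr1; move: h; rewrite -exprVn -/i; lra.
Qed.

Let expR_natl_ge (k : nat) : 2 ^+ k <= expR k%:R :> R.
Proof.
rewrite -[k%:R]mulr1 expRM_natl lerXn2r ?nnegrE ?expR_ge0 //.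
by have := expR_ge1Dx (1 : R); lra.
Qed.

Let D_le : D.+1%:R <= expR (4 + a + 2 * b).
Proof.
rewrite (expRD (4 + a)) (expRD 4) expa (expRM_natl 2) expb -mulrA.
have h4 := expR_natl_ge 4.
have M2 : 2 <= M%:R :> R by rewrite ler_nat.
have i4 : 4 <= i ^+ 2 by have := i_ge2; nra.
rewrite -natr1 natrD natrM; have := T_le.
have : 17 * i ^+ 2 + 2 * M%:R + 1 <= 16 * (M%:R * i ^+ 2) by nra.
have : 16 * (M%:R * i ^+ 2) <= expR 4 * (M%:R * i ^+ 2).
  have h16 : 16 <= expR 4 :> R by move: h4; lra.
  by rewrite ler_wpM2r // mulr_ge0 ?sqr_ge0.
lra.
Qed.

(** All programs are quantified over, because [G] and [sigma] must be fixed before the state and the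
    analyst. *)
Definition suffices (G : nat) (sigma : R) : Prop :=
  forall (Y : finType) (P : Y -> R) (wrong : (Y -> bool) -> bool -> bool) (t : prog Y bool),
  (forall y, 0 <= P y) -> \sum_y P y = 1 ->
  (forall h c, wrong h c -> \sum_(y | h y == c) P y <= 100^-1) ->
  bud (fun _ _ _ => True) T D t -> fail_prob wrong G sigma P t <= delta.

(** With [lam] about [10 l] and [sigma] of order [sqrt (T l)], the total charge [kap * T] is at most
    [lam / 2], so the privacy error is at most [expR (- 5 l)]; and [G / (4 sigma) >= 40 a l]
    outweighs the number [D] of tests. *)
Lemma private_group_count : l <= i ^+ 2 ->
  exists G sigma, G%:R <= 10 ^+ 5 * Q /\ suffices G sigma.
Proof.
move=> li; have r0 : 0 < r by have := r_ge; lra.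
have ri : r <= i.
  by rewrite -ler_sqr ?nnegrE ?(ltW r0) ?r2 //; have := i_ge2; lra.
have i0 : 0 < i by have := i_ge2; lra.
pose lam := (Num.truncn (10 * l)).+1; pose sigma := 200 * r * i.
have s0 : 0 < sigma by rewrite !mulr_gt0.
have al4 : 4^-1 <= a * l by have := a_ge; have := l_ge; nra.
have lam1 : 10 * l <= lam%:R by rewrite ltW // truncnS_gt.
have lam2 : lam%:R <= 12 * l.
  have : (Num.truncn (10 * l))%:R <= 10 * l by rewrite truncn_le; have := l_ge; lra.
  by rewrite /lam -natr1; have := l_ge; lra.
pose kap := 8 * (lam%:R / sigma) ^+ 2.
pose G := (Num.truncn (160 * sigma * (a * l))).+1.
have G1 : 160 * sigma * (a * l) <= G%:R by rewrite ltW // truncnS_gt.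
have al0 : 0 <= a * l by lra.
have sal0 : 0 <= 160 * sigma * (a * l).
  by apply: mulr_ge0 al0; apply: mulr_ge0 => //; exact: ltW.
exists G, sigma; split.
  have : (Num.truncn (160 * sigma * (a * l)))%:R <= 160 * sigma * (a * l) by rewrite truncn_le.
  rewrite /G -natr1 => h.
  have eQ : 160 * sigma * (a * l) * b = 32 * 10 ^+ 3 * Q.
    by rewrite /sigma /Q -r2; ring.
  have : 160 * sigma * (a * l) * 2^-1 <= 32 * 10 ^+ 3 * Q by rewrite -eQ ler_wpM2l.
  by have := Q_ge; lra.
move=> Y P wrong t P0 P1 wP bt.
have ls : lam%:R / sigma <= 16^-1.
  (* Here [r <= i] keeps [lam / sigma <= 12 r / (200 i)] below 1/16. *)
  rewrite ler_pdivrMr //; apply: (le_trans lam2); rewrite /sigma -r2 expr2.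
  have := ler_wpM2l (ltW r0) ri; have := mulr_gt0 r0 i0; lra.
have kT : kap * T%:R <= lam%:R / 2.
  have lam0 : 0 <= lam%:R :> R by [].
  have -> : kap * T%:R = lam%:R / 2 * (16 * (lam%:R * T%:R) / sigma ^+ 2).
    by rewrite /kap; field; rewrite gt_eqF.
  rewrite ler_piMr ?divr_ge0 // ler_pdivrMr ?exprn_gt0 // mul1r.
  have : lam%:R * T%:R <= (12 * l) * (17 * i ^+ 2) by rewrite ler_pM.
  have -> : sigma ^+ 2 = 4 * 10 ^+ 4 * (l * i ^+ 2) by rewrite /sigma -r2; ring.
  have : 0 <= l * i ^+ 2 by rewrite mulr_ge0 ?exprn_ge0 ?(ltW i0) //; have := l_ge; lra.
  by lra.
apply: le_trans (fail_le_private P0 P1 wP _ s0 _ ls (erefl kap) bt) _ => //.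
have ed0 : 0 < eps * delta by rewrite mulr_gt0.
have ed : eps * delta <= delta / 2 by have := eps_lt; have := delta_gt0; nra.
have d0 : expR (- lam%:R + kap * T%:R) <= delta / 10.
  apply: (@le_trans _ _ (expR (5%:R * - l))); first by rewrite ler_expR; lra.
  rewrite expRM_natl expNl.
  apply: (@le_trans _ _ ((delta / 2) ^+ 5)).
    by rewrite lerXn2r ?nnegrE ?(ltW ed0) ?divr_ge0 ?(ltW delta_gt0).
  have -> : (delta / 2) ^+ 5 = delta * delta ^+ 4 / 32 by field.
  have : delta ^+ 4 <= 1 by rewrite exprn_ile1 // ltW.
  by have := delta_gt0; nra.
have be : D%:R * expR (- (G%:R / (4 * sigma))) <= delta / 10.
  apply: (@le_trans _ _ (expR (4 + a + 2 * b) * expR (- (40 * (a * l))))).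
    apply: ler_pM => //; first by rewrite expR_ge0.
      by apply: le_trans D_le; rewrite ler_nat.
    rewrite ler_expR lerN2 ler_pdivlMr ?mulr_gt0 //; lra.
  rewrite -expRD; apply: (@le_trans _ _ (expR (- l) * expR (- 3%:R))).
    rewrite -expRD ler_expR.
    (* As [a] and [l] are at least 1/2, the product [a * l] dominates both, as well as the constants
       and [b <= l]. *)
    have : a <= 2 * (a * l) by have := l_ge; have := a_ge; nra.
    have : l <= 2 * (a * l) by have := l_ge; have := a_ge; nra.
    have := b_le; lra.
  rewrite expNl expRN; have h3 := expR_natl_ge 3.
  have h8 : (expR 3)^-1 <= 8^-1 :> R by rewrite lef_pV2 ?posrE ?expR_gt0 //; lra.
  have := ler_pM (ltW ed0) _ ed h8; rewrite invr_ge0 expR_ge0 => /(_ isT).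
  have := delta_gt0; lra.
lra.
Qed.

(** The path count is at most [expR (T * u)], and [G >= 5/2 (T u + l)] leaves failure probability at
    most [expR (- l) = eps * delta]. The term [T u] is of order [i^2 a b], which [i <= r] bounds by
    a multiple of [Q]. *)
Lemma union_group_count : i ^+ 2 <= l ->
  exists G sigma, G%:R <= 10 ^+ 5 * Q /\ suffices G sigma.
Proof.
move=> il; have r0 : 0 < r by have := r_ge; lra.
have i0 : 0 < i by have := i_ge2; lra.
have ri : i <= r by rewrite -ler_sqr ?nnegrE ?(ltW r0) ?(ltW i0) // r2.
pose u := 4 + a + 2 * b; pose v := 5 / 2 * (T%:R * u + l).
have u0 : 0 <= u by rewrite /u; have := a_ge; have := b_ge; lra.
have Tu0 : 0 <= T%:R * u by rewrite mulr_ge0.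
have v0 : 0 <= v by rewrite /v; have := l_ge; lra.
have G1 : v <= (Num.truncn v).+1%:R by rewrite ltW // truncnS_gt.
exists (Num.truncn v).+1, 1; split.
  have : (Num.truncn v)%:R <= v by rewrite truncn_le.
  rewrite -natr1 => h.
  have uab : u <= 22 * (a * b) by rewrite /u; have := a_ge; have := b_ge; nra.
  have ab0 : 0 <= a * b by have := ab_ge; lra.
  have Tu : T%:R * u <= 17 * i ^+ 2 * (22 * (a * b)) by rewrite ler_pM.
  have ir0 : 0 <= i * r by rewrite mulr_ge0 // ltW.
  have i2 : i ^+ 2 <= i * r by rewrite expr2 ler_wpM2l // ltW.
  have rr : 1 <= 2 * r ^+ 2 by have := l_ge; rewrite -r2; lra.
  have h1 : i * r * (a * b) <= 2 * Q.
    have -> : 2 * Q = i * r * (a * b) * (2 * r ^+ 2) by rewrite /Q; ring.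
    by rewrite ler_peMr // mulr_ge0.
  have h2 : i ^+ 2 * (a * b) <= i * r * (a * b) by rewrite ler_wpM2r.
  have h3 : l <= 4 * Q.
    have -> : 4 * Q = r ^+ 2 * (2 * r) * ((4 * (a * b)) * (i / 2)) by rewrite /Q; field.
    rewrite -r2 -mulrA ler_peMr ?sqr_ge0 //.
    have s1 : 1 <= 2 * r by have := r_ge; lra.
    have s2 : 1 <= 4 * (a * b) by have := ab_ge; lra.
    have s3 : 1 <= i / 2 by have := i_ge2; lra.
    by rewrite mulr_ege1 // mulr_ege1.
  have := Q_ge; rewrite /v in h *; lra.
move=> Y P wrong t P0 P1 wP bt.
apply: le_trans (fail_le_union _ P0 P1 wP (erefl 1) bt) _.
apply: (@le_trans _ _ (expR (T%:R * u) * expR (- (2 / 5 * v)))).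
  apply: ler_pM; rewrite ?exprn_ge0 ?expR_ge0 //.
    rewrite expRM_natl lerXn2r ?nnegrE ?expR_ge0 //.
  by rewrite ler_expR lerN2; have := G1; lra.
rewrite -expRD (_ : T%:R * u - 2 / 5 * v = - l); last by rewrite /v; field.
rewrite expNl; have := delta_gt0; have := eps_lt; nra.
Qed.

Lemma group_count : exists G sigma, G%:R <= 10 ^+ 5 * Q /\ suffices G sigma.
Proof.
by have [/private_group_count//|/ltW/union_group_count] := leP l (i ^+ 2).
Qed.

End SampleSize.

(** * Assembly of the sample bound, with large [eps] treated apart *)

Theorem mainTheorem13 :
  forall R : realType, exists c : R, 0 < c /\
  forall (n M : nat) (eps delta : R),
    (2 <= M)%N -> 0 < eps < 1 -> 0 < delta < 1 ->
    exists (N K L J : nat) (alg : algorithm R (2 ^ n) N K L J),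
      [/\ N%:R <= c * (ln (M%:R : R) * (ln (1 / (eps * delta))) `^ (3 / 2)
                        * ln (1 / eps)) / eps ^+ 3,
          valid_algorithm alg
        & forall rho : 'M[R[i]]_(2 ^ n), density_matrix rho ->
          forall A : history R (2 ^ n) -> 'cV[R[i]]_(2 ^ n),
            (forall h, unit_vector (A h)) ->
            (((1 - delta)%:C)%C <= success_prob rho alg A eps M)%R].
Proof.
(* [10^5] bounds the number of groups against [Q], and [1601 * 4^7] the group size against
   [1 / eps^2]. *)
move=> R; exists (10 ^+ 5 * (1601 * 4 ^+ 7)); split; first by rewrite !mulr_gt0 ?exprn_gt0.
move=> n M eps delta M2 /andP[e0 e1] /andP[d0 d1].
have [e2|e2] := ltP eps 2^-1; last first.
  (* For [eps >= 1/2] the constant answer 1/2 is accurate with zero copies, as expectation values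
     lie in [[0, 1]]. *)
  pose p (_ : {ffun 'I_0 -> {ffun 'I_(2 ^ n) -> alphabet}})
    (_ : history R (2 ^ n)) (_ : 'cV[R[i]]_(2 ^ n)) (_ : 'I_1) : R := 1.
  pose est (_ : history R (2 ^ n)) (_ : 'cV[R[i]]_(2 ^ n)) (_ : 'I_1) : R := 2^-1.
  pose alg := simulation (@gvec R (2 ^ n)) p est.
  exists 0%N, _, _, _, alg; split.
  - rewrite !mulr_ge0 ?invr_ge0 ?exprn_ge0 ?powR_ge0 ?(ltW e0) //.
      by rewrite ln_ge0 // ler1n; lia.
    by rewrite ln_ge0 // div1r invf_ge1 // ltW.
  - apply: simulation_valid => // [|s h psi]; first exact: gvec_povm.
    by rewrite big_ord1.
  move=> rho rhoD A uA; rewrite success_prob_simulation // lecR.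
  have okE k h s : answers_ok p est rho A eps k h s = 1.
    elim: k h => [//|k IH] h /=; rewrite /p big_ord1 IH mulr1 ifT //.
    have /andP[v0 v1] := density_expval rhoD (uA h).
    by apply: le_trans e2; rewrite /est ler_norml; apply/andP; split; lra.
  under eq_bigr do rewrite okE mulr1.
  by rewrite (prodw_sum1 _ (born_sum1 rhoD)); lra.
have [G [sigma [Gle suff]]] := group_count M2 e0 e2 d0 d1.
set T := corrections eps in suff.
(* [1600 = 100 * 16] combines the failure bound 1/100 of a group with [eta^2 = eps^2 / 16]. *)
pose m := (Num.truncn (1600 * 4 ^+ 7 / eps ^+ 2)).+1.
have e20 : 0 < eps ^+ 2 by rewrite exprn_gt0.
have mL : 100 * 4 ^+ 7 <= m%:R * (eps / 4) ^+ 2.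
  have : 1600 * 4 ^+ 7 / eps ^+ 2 <= m%:R by rewrite ltW // truncnS_gt.
  by rewrite ler_pdivrMr //; lra.
have TL : 1 < T%:R * (eps / 4) ^+ 2.
  have : 16 / eps ^+ 2 < T%:R by exact: truncnS_gt.
  by rewrite ltr_pdivrMr //; lra.
exists (G * m)%N, _, _, _, (learner (2 ^ n) G m T eps sigma); split.
- have mle : m%:R <= 1601 * 4 ^+ 7 * eps^-1 ^+ 2.
    have : (Num.truncn (1600 * 4 ^+ 7 / eps ^+ 2))%:R <= 1600 * 4 ^+ 7 / eps ^+ 2.
      by rewrite truncn_le divr_ge0 ?(ltW e20) ?mulr_ge0 ?exprn_ge0.
    have : 1 <= eps^-1 ^+ 2 by apply: exprn_ege1; rewrite invf_ge1 // ltW.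
    by rewrite /m -natr1 exprVn; lra.
  have l0 : 0 <= ln (1 / (eps * delta)).
    by rewrite ln_ge0 // div1r invf_ge1 ?mulr_gt0 // mulr_ile1 // ltW.
  rewrite natrM; apply: le_trans (ler_pM _ _ Gle mle) _ => //.
  rewrite (_ : 3 / 2 = 1 + 2^-1 :> R); last by field.
  rewrite powRD; last by apply/implyP; lra.
  rewrite powRr1 // powR12_sqrt //.
  set s := Num.sqrt _; have -> : ln (1 / (eps * delta)) = s ^+ 2 by rewrite sqr_sqrtr.
  by rewrite le_eqVlt; apply/orP; left; apply/eqP; field; rewrite gt_eqF.
- exact: learner_valid.
move=> rho rhoD A uA; apply: learner_success => //.
apply: suff.
- by move=> y; apply: prodw_ge0; exact: born_ge0.
- exact: prodw_sum1 (born_sum1 rhoD).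
- by [].
by apply: (interaction_bud m rho A (h := [::]) (n := M)).
Qed.
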